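(* Let $\mathcal L:\sum_{i=1}^kc_ix_i=0$ be a homogeneous linear equation with $k\ge3$ and $c_1,\dots,c_k\in\mathbb Z\setminus\{0\}$, and assume there is no $I\subseteq[k]$ with $|I|\ge3$ and $\sum_{i\in I}c_i=0$. Then there exists $\varepsilon>0$ such that for every integer $t$ and every sufficiently large prime $p$ (depending on $t$ and $\mathcal L$), there is an $\mathcal L$-solution-free set $A\subseteq\mathbb F_p$ with $|A|\ge\varepsilon p$ and $\chi(\mathsf{Cay}(\mathbb F_p,A))\ge t$.
   Context: A set $A\subseteq\mathbb F_p$ is $\mathcal L$-solution-free if there is no $(x_1,\dots,x_k)\in A^k$ with pairwise distinct entries and $\sum_ic_ix_i=0$ in $\mathbb F_p$. $\mathsf{Cay}(\mathbb F_p,A)$ is the Cayley digraph with arc $u\to v$ iff $v-u\in A$; $\chi$ is the chromatic number of its underlying undirected graph. *)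

(* Defs.v *)
From mathcomp Require Import all_boot all_order all_algebra.
Set Implicit Arguments. Unset Strict Implicit. Unset Printing Implicit Defensive.
Import Order.TTheory GRing.Theory Num.Theory.
Local Open Scope ring_scope.

Definition solution_free (p k : nat) (c : 'I_k -> int) (A : {set 'F_p}) : Prop :=
  ~ exists x : 'I_k -> 'F_p,
      [/\ injective x, (forall i, x i \in A) &
          \sum_(i < k) (c i)%:~R * x i = 0].

Definition cay_adj (p : nat) (A : {set 'F_p}) (u v : 'F_p) : bool :=
  (u != v) && ((v - u \in A) || (u - v \in A)).

Definition proper_coloring (p n : nat) (A : {set 'F_p}) (f : 'F_p -> 'I_n) : Prop :=
  forall u v, cay_adj A u v -> f u != f v.

Definition chi_ge (p : nat) (A : {set 'F_p}) (t : nat) : Prop :=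
  forall n : nat, (n < t)%N -> ~ exists f : 'F_p -> 'I_n, proper_coloring A f.

(* Main.v *)
Require Import Defs.
From mathcomp Require Import all_boot all_order all_algebra.
From mathcomp Require Import ring lra zify.
Set Implicit Arguments. Unset Strict Implicit. Unset Printing Implicit Defensive.
Import Order.TTheory GRing.Theory Num.Theory.
Local Open Scope ring_scope.

(** The set is A = S u D with S sparse, of large chromatic number, and D dense. Let C be the
    sum of the c_i and q a prime not dividing C. Vectors of F_q^d are embedded in the integers
    through digits in base q L with leading part b_j L, so that adding 1 to a coordinate wraps
    around modulo q. S consists of the differences of vectors u, v with u = v + 1 outside few
    coordinates (times a constant). Any colouring of F_q^d with n colours has a monochromatic
    such pair: this is a Borsuk-Ulam theorem for the cyclic group of order q, proved by pairing
    explicit cochains with chains in a contractible complex. D lies in a short interval away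
    from 0, so that a solution in A either lies in S, or has exactly two entries in D, with
    opposite coefficients. In both cases the other coefficients sum to C, and the solution
    reads: C = 0 in F_q, or two points of D differ by about the constant vector C. The latter
    is excluded by taking D inside a set defined by thresholds for a statistic with
    fluctuations of order sqrt d, which is insensitive to changing a few coordinates. *)

(** * Cochains on lists *)

(* Cochains are functions on lists; a list of length d+1 is an ordered d-simplex, and the
   empty list makes the complex augmented. *)
Fixpoint coboundary (R : comNzRingType) (Q : Type) (G : seq Q -> R) (s : seq Q) : R :=
  if s is x :: s' then G s' - coboundary (fun l => G (x :: l)) s' else 0.

(** The dual of the prism of algebraic topology: the entry at which the list passes from [f] to [g]
    is repeated. *)
Fixpoint prism (R : comNzRingType) (Q : Type) (f g : Q -> Q) (G : seq Q -> R)
    (s : seq Q) : R :=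
  if s is x :: s' then
    G (f x :: g x :: map g s') - prism f g (fun l => G (f x :: l)) s'
  else 0.

Lemma coboundary_cons (R : comNzRingType) (Q : Type) (G : seq Q -> R) x s :
  coboundary G (x :: s) = G s - coboundary (fun l => G (x :: l)) s.
Proof. by []. Qed.

Lemma eq_coboundary (R : comNzRingType) (Q : Type) (G G' : seq Q -> R) :
  G =1 G' -> coboundary G =1 coboundary G'.
Proof.
move=> eqG s; elim: s G G' eqG => //= x s IHs G G' eqG.
by rewrite eqG (IHs _ (fun l => G' (x :: l))).
Qed.

Lemma coboundary_sum (R : comNzRingType) (Q : Type) (I : Type) (r : seq I)
    (G : I -> seq Q -> R) s :
  coboundary (fun l => \sum_(i <- r) G i l) s = \sum_(i <- r) coboundary (G i) s.
Proof.
elim: s G => [|x s IHs] G /=; first by rewrite big1_eq.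
by rewrite (IHs (fun i l => G i (x :: l))) sumrB.
Qed.

Lemma coboundaryB (R : comNzRingType) (Q : Type) (G G' : seq Q -> R) s :
  coboundary (fun l => G l - G' l) s = coboundary G s - coboundary G' s.
Proof.
elim: s G G' => [|x s IHs] G G' /=; first by rewrite subr0.
by rewrite (IHs (fun l => G (x :: l))); ring.
Qed.

Lemma coboundaryZ (R : comNzRingType) (Q : Type) (a : R) (G : seq Q -> R) s :
  coboundary (fun l => a * G l) s = a * coboundary G s.
Proof.
elim: s G => [|x s IHs] G /=; first by rewrite mulr0.
by rewrite (IHs (fun l => G (x :: l))) mulrBr.
Qed.

Lemma coboundary_map (R : comNzRingType) (Q Q' : Type) (f : Q -> Q')
    (G : seq Q' -> R) s :
  coboundary (fun l => G (map f l)) s = coboundary G (map f s).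
Proof. by elim: s G => //= x s IHs G; rewrite (IHs (fun l => G (f x :: l))). Qed.

(** The hypothesis concerns only the lists on which [prism] evaluates its cochain, so that cochains
    can later be compared on thin chains alone. *)
Lemma eq_prism (R : comNzRingType) (Q : Type) (f g : Q -> Q) (G G' : seq Q -> R) s :
  (forall s1 x s2, s = s1 ++ x :: s2 ->
    G (map f (rcons s1 x) ++ map g (x :: s2)) =
    G' (map f (rcons s1 x) ++ map g (x :: s2))) ->
  prism f g G s = prism f g G' s.
Proof.
elim: s G G' => //= x s IHs G G' eqG.
rewrite (eqG [::] x s erefl) (IHs _ (fun l => G' (f x :: l))) // => s1 y s2 eqs.
by apply: (eqG (x :: s1)); rewrite eqs.
Qed.

Lemma prismB (R : comNzRingType) (Q : Type) (f g : Q -> Q) (G G' : seq Q -> R) s :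
  prism f g (fun l => G l - G' l) s = prism f g G s - prism f g G' s.
Proof.
elim: s G G' => [|x s IHs] G G' /=; first by rewrite subr0.
by rewrite (IHs (fun l => G (f x :: l))); ring.
Qed.

Lemma prism_homotopy (R : comNzRingType) (Q : Type) (f g : Q -> Q) (G : seq Q -> R) s :
  prism f g (coboundary G) s + coboundary (prism f g G) s =
  G (map g s) - G (map f s).
Proof.
elim: s G => [|x s IHs] G /=; first by rewrite addr0 subrr.
rewrite prismB coboundaryB (coboundary_map g (fun l => G [:: f x, g x & l])).
have {IHs} := IHs (fun l => G (f x :: l)).
move=> /(canRL (addKr _)) ->; ring.
Qed.

(** * Cocycles of the cyclic group *)

(* Whether the residue 0 is met when going upwards from [a] (excluded) to [b] (included). *)
Definition wrap (q : nat) (a b : 'F_q) : 'F_q := ((b < a)%N)%:R.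

(** The coboundary of [wrap]: the carry produced by adding the residues [b - a] and [e - b]. *)
Definition carry (q : nat) (a b e : 'F_q) : 'F_q := wrap b e - wrap a e + wrap a b.

(** The cup power of the cocycle [carry]; on a list of even length the last entry is ignored. *)
Fixpoint carries (q : nat) (l : seq 'F_q) : 'F_q :=
  match l with
  | a :: ((b :: ((e :: _) as l2))) => carry a b e * carries l2
  | _ => 1
  end.

Arguments carries : simpl never.

Lemma carries_cons3 (q : nat) (a b e : 'F_q) (l : seq 'F_q) :
  carries [:: a, b, e & l] = carry a b e * carries (e :: l).
Proof. by []. Qed.

(* Pulled back along a labelling by residues, these represent the generators of the
   cohomology of the cyclic group in the periodic resolution: the coboundary of each is
   the next one, acted upon by [T - 1] or by the norm. *)
Definition fan (q d : nat) (l : seq 'F_q) : 'F_q :=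
  match odd d, l with
  | false, a :: _ => (a == -1)%:R * carries l
  | true, a :: (b :: _) as l' => wrap a b * carries l'
  | _, _ => 0
  end.

Lemma val_Fp_succ (q : nat) (a : 'F_q) :
  val (a + 1) = if a == -1 then 0%N else (val a).+1.
Proof.
have [->|neq] := eqVneq; first by rewrite addNr.
rewrite /= [(1 %% _)%N]modn_small // addn1 modn_small //.
rewrite ltn_neqAle ltn_ord andbT; apply: contra neq => /eqP eqa.
by rewrite -subr_eq0 opprK -val_eqE /= [(1 %% _)%N]modn_small // addn1 eqa modnn.
Qed.

(** A residue changes its order relative to others only when it passes from -1 to 0. The right side
    is the coboundary of the indicator of -1, so it disappears in [carry]. *)
Lemma wrapD1 (q : nat) (a b : 'F_q) :
  wrap (a + 1) (b + 1) - wrap a b = (b == -1)%:R - (a == -1)%:R.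
Proof.
rewrite /wrap !val_Fp_succ.
have top (e : 'F_q) : (val e <= val (-1 : 'F_q)%R)%N.
  have := val_Fp_succ (-1 : 'F_q); rewrite eqxx.
  have := ltn_ord e; rewrite ltnS => le_e _; apply: leq_trans le_e _.
  by rewrite /= [(1 %% _)%N]modn_small // subSS subn0 modn_small.
have lt_top (e : 'F_q) : e != -1 -> (val e < val (-1 : 'F_q)%R)%N.
  by move=> ne; rewrite ltn_neqAle top andbT val_eqE.
case: (eqVneq a) => [->|na]; case: (eqVneq b) => [->|nb]; rewrite ?ltnS.
- by rewrite !ltnn !subrr.
- by rewrite ltn0 lt_top // sub0r.
- by have := top a; rewrite leqNgt => /negPf ->.
- by rewrite !subrr.
Qed.

Lemma carryD1 (q : nat) (a b e : 'F_q) :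
  carry (a + 1) (b + 1) (e + 1) = carry a b e.
Proof.
have := wrapD1 a b; have := wrapD1 b e; have := wrapD1 a e; rewrite /carry.
move=> /(canRL (subrK _)) -> /(canRL (subrK _)) -> /(canRL (subrK _)) ->; ring.
Qed.

Lemma carriesD1 (q : nat) (l : seq 'F_q) :
  carries (map (fun a => a + 1) l) = carries l.
Proof.
have [m le_lm] := ubnP (size l); elim: m l le_lm => // m IHm.
case=> [|a [|b [|e l]]] //= le_lm.
by rewrite !carries_cons3 carryD1 -(IHm (e :: l)) //=; lia.
Qed.

Lemma carriesD (q : nat) (c : 'F_q) (l : seq 'F_q) :
  carries (map (fun a => a + c) l) = carries l.
Proof.
rewrite -[c]natr_Zp; elim: (val c) => [|n IHn].
  by rewrite (eq_map (g := id)) ?map_id // => a /=; rewrite addr0.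
rewrite -IHn -[RHS]carriesD1 -map_comp; congr carries; apply: eq_map => a /=.
by rewrite -natr1 addrA.
Qed.

(** Even lengths are those on which the coboundary of a cochain of even degree is evaluated, and in
    even degree [carries] is a product of cocycles. *)
Lemma carries_cocycle (q : nat) (l : seq 'F_q) :
  ~~ odd (size l) -> coboundary (@carries q) l = 0.
Proof.
have [m le_lm] := ubnP (size l); elim: m l le_lm => // m IHm.
case=> [|a [|b [|e [|f l]]]] //= le_lm; first by rewrite !subr0 subrr.
rewrite !negbK => even_l.
rewrite (eq_coboundary (G' := fun s => carry a b e * carries [:: e, f & s])) //.
rewrite (coboundaryZ (carry a b e) (fun s => carries [:: e, f & s])).
have /= := IHm [:: e, f & l]; rewrite negbK even_l => /(_ ltac:(lia) isT).
rewrite !carries_cons3 => /eqP; rewrite subr_eq0 => /eqP E.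
have {E}-> : coboundary (fun s => carries [:: e, f & s]) l =
   carries (e :: l) - carries (f :: l) by rewrite E opprB addrCA subrr addr0.
rewrite /carry; ring.
Qed.

Lemma coboundary_carries_cons (q : nat) (a b : 'F_q) (l : seq 'F_q) :
  ~~ odd (size l) ->
  coboundary (fun s => carries (a :: s)) (b :: l) = carries (b :: l).
Proof.
move=> even_l; have := @carries_cocycle q [:: a, b & l].
by rewrite /= negbK even_l => /(_ isT) /eqP; rewrite subr_eq0 => /eqP /= ->.
Qed.

Lemma fan_odd (q d : nat) (a b : 'F_q) (l : seq 'F_q) :
  odd d -> fan d [:: a, b & l] = wrap a b * carries (b :: l).
Proof. by rewrite /fan => ->. Qed.

Lemma fan_even (q d : nat) (a : 'F_q) (l : seq 'F_q) :
  ~~ odd d -> fan d (a :: l) = (a == -1)%:R * carries (a :: l).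
Proof. by rewrite /fan => /negPf->. Qed.

Lemma coboundary_fan_even (q d : nat) (l : seq 'F_q) :
  ~~ odd d -> size l = d.+2 ->
  coboundary (fan d) l = fan d.+1 (map (fun a => a + 1) l) - fan d.+1 l.
Proof.
move=> even_d; case: l => [|a [|b l]] // [size_l].
have := @coboundary_carries_cons q a b l; rewrite size_l => /(_ even_d) E.
have C1 : carries (b + 1 :: map (fun a => a + 1) l) = carries (b :: l) :=
  carriesD1 (b :: l).
rewrite [map _ _]/= !fan_odd // C1 -mulrBl wrapD1.
rewrite coboundary_cons.
rewrite (eq_coboundary (G' := fun s => (a == -1)%:R * carries (a :: s))) => [|s].
  by rewrite coboundaryZ E fan_even // mulrBl.
exact: fan_even.
Qed.

(** The right side is the norm of [fan d.+1]: among the translates of [l] exactly one starts at -1,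
    and [carries] is the same on all of them. *)
Lemma coboundary_fan_odd (q d : nat) (l : seq 'F_q) :
  odd d -> size l = d.+2 -> coboundary (fan d) l = carries l.
Proof.
move=> odd_d; case: l => [|a [|b [|e l]]] // [size_l]; first by rewrite -size_l in odd_d.
have even_l : ~~ odd (size l) by rewrite -size_l in odd_d.
have E := coboundary_carries_cons b e even_l.
rewrite coboundary_cons [X in _ - X]coboundary_cons.
rewrite (eq_coboundary (G' := fun s => wrap a b * carries (b :: s))) => [|s].
  by rewrite coboundaryZ E !fan_odd // carries_cons3 /carry; ring.
exact: fan_odd.
Qed.

Lemma wrapxx (q : nat) (a : 'F_q) : wrap a a = 0.
Proof. by rewrite /wrap ltnn. Qed.

(** In odd length any two neighbours belong to a common factor [carry a b e], which vanishes if
    [a = b] or [b = e]. *)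
Lemma carries_eq0 (q : nat) (l : seq 'F_q) :
  odd (size l) -> ~~ sorted (fun a b => a != b) l -> carries l = 0.
Proof.
have [m le_lm] := ubnP (size l); elim: m l le_lm => // m IHm.
case=> [|a [|b [|e l]]] // le_lm; rewrite [size _]/= [odd _]/= negbK => odd_l.
rewrite [sorted _ _]/= !negb_and !negbK carries_cons3 /carry.
case/or3P => [/eqP <- | /eqP <- | ns].
- by rewrite wrapxx addr0 subrr mul0r.
- by rewrite wrapxx add0r addNr mul0r.
- by rewrite (IHm (e :: l)) ?mulr0 //=; move: le_lm => /=; lia.
Qed.

Lemma fan_eq0 (q d : nat) (l : seq 'F_q) :
  size l = d.+1 -> ~~ sorted (fun a b => a != b) l -> fan d l = 0.
Proof.
case: (boolP (odd d)) => odd_d.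
  case: l => [|a [|b l]] // [size_l].
  rewrite fan_odd // [sorted _ _]/= negb_and negbK => /orP[/eqP <-|ns].
    by rewrite wrapxx mul0r.
  by rewrite carries_eq0 ?mulr0 // [size _]size_l.
case: l => [|a l] // [size_l] ns; rewrite fan_even // carries_eq0 ?mulr0 //.
by rewrite /= size_l.
Qed.

(** * Near-shifts in F_q^N get the same colour *)

Definition shift (q N : nat) (c : 'F_q) (x : {ffun 'I_N -> 'F_q}) :
  {ffun 'I_N -> 'F_q} := [ffun j => x j + c].

Definition hamming (q N : nat) (x y : {ffun 'I_N -> 'F_q}) : nat :=
  #|[set j | x j != y j]|.

Definition shift_set (q N : nat) (c : 'F_q) (s : {set {ffun 'I_N -> 'F_q}}) :
  {set {ffun 'I_N -> 'F_q}} := [set shift c x | x in s].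

Definition zero_below (q N i : nat) (x : {ffun 'I_N -> 'F_q}) :
  {ffun 'I_N -> 'F_q} := [ffun j : 'I_N => if (j < i)%N then 0 else x j].

Definition zero_set (q N i : nat) (s : {set {ffun 'I_N -> 'F_q}}) :
  {set {ffun 'I_N -> 'F_q}} := [set zero_below i x | x in s].

(** Coordinates are set to 0 one at a time. Both [zero_set i] and [zero_set i.+1] are contained in
    this union, so two prisms lead from one to the other through maps comparable for inclusion. *)
Definition zero_step (q N i : nat) (s : {set {ffun 'I_N -> 'F_q}}) :
  {set {ffun 'I_N -> 'F_q}} := zero_set i s :|: zero_set i.+1 s.

Definition contraction (q N : nat) (G : seq {set {ffun 'I_N -> 'F_q}} -> 'F_q)
    (s : seq {set {ffun 'I_N -> 'F_q}}) : 'F_q :=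
  \sum_(i < N) (prism (zero_set i) (zero_step i) G s -
                prism (zero_set i.+1) (zero_step i) G s).

Lemma zero_set0 (q N : nat) (s : {set {ffun 'I_N -> 'F_q}}) : zero_set 0 s = s.
Proof.
rewrite /zero_set (eq_imset (g := id)) ?imset_id // => x.
by apply/ffunP => j; rewrite ffunE.
Qed.

Lemma contraction_homotopy (q N : nat) (G : seq {set {ffun 'I_N -> 'F_q}} -> 'F_q) s :
  contraction (coboundary G) s + coboundary (contraction G) s =
  G (map (zero_set N) s) - G s.
Proof.
rewrite /contraction coboundary_sum -big_split /=.
rewrite (eq_bigr (fun i : 'I_N =>
    G (map (zero_set i.+1) s) - G (map (zero_set i) s))); last first.
  by move=> i _; rewrite coboundaryB addrACA -opprD !prism_homotopy; ring.
rewrite -(big_mkord xpredT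
  (fun i => G (map (zero_set i.+1) s) - G (map (zero_set i) s))).
rewrite telescope_sumr // (eq_map (g := id) (f := zero_set 0)) ?map_id //.
exact: zero_set0.
Qed.

(* The norm (in even degree) and [T - 1] (in odd degree), alternating as in the periodic
   resolution but with parities opposite to those satisfied by [fan]. *)
Definition periodic_op (q N d : nat) (G : seq {set {ffun 'I_N -> 'F_q}} -> 'F_q)
    (s : seq {set {ffun 'I_N -> 'F_q}}) : 'F_q :=
  if odd d then G (map (shift_set 1) s) - G s
  else \sum_(c : 'F_q) G (map (shift_set c) s).

(* Evaluation on a d-chain of the contractible complex of small sets, built degree by degree
   so that its boundary is, up to sign, the [periodic_op]-image of the previous one. *)
Fixpoint cycle_eval (q N d : nat) (G : seq {set {ffun 'I_N -> 'F_q}} -> 'F_q) : 'F_q :=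
  if d is d'.+1 then cycle_eval d' (periodic_op d' (contraction G)) else G [:: [set [ffun=> 0]]].

(** One parameter bounds both the degree and the Hamming diameter, since a contraction adds one
    vertex and at most 1 to the diameter. *)
Definition thin (q N d : nat) (s : seq {set {ffun 'I_N -> 'F_q}}) : Prop :=
  [/\ size s = d.+1, pairwise (fun A B : {set _} => A \subset B) s &
      forall A, A \in s -> A != set0 /\ {in A &, forall x y, (hamming x y <= d)%N}].

Lemma shift_setD (q N : nat) (c e : 'F_q) (A : {set {ffun 'I_N -> 'F_q}}) :
  shift_set c (shift_set e A) = shift_set (e + c) A.
Proof.
rewrite /shift_set -imset_comp; apply: eq_imset => x.
by apply/ffunP => j; rewrite !ffunE addrA.
Qed.

Lemma coboundary_periodic_op (q N d : nat) (G : seq {set {ffun 'I_N -> 'F_q}} -> 'F_q) s :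
  coboundary (periodic_op d G) s = periodic_op d (coboundary G) s.
Proof.
rewrite /periodic_op; case: ifP => _.
  by rewrite coboundaryB coboundary_map.
by rewrite coboundary_sum; apply: eq_bigr => c _; rewrite coboundary_map.
Qed.

Lemma periodic_op_periodic_op (q N d : nat) (G : seq {set {ffun 'I_N -> 'F_q}} -> 'F_q) s :
  periodic_op d (periodic_op d.+1 G) s = 0.
Proof.
rewrite /periodic_op /=; case: (odd d) => /=.
  apply/eqP; rewrite subr_eq0; apply/eqP.
  rewrite [RHS](reindex_inj (addrI 1)) /=; apply: eq_bigr => c _.
  by rewrite -map_comp; congr G; apply: eq_map => A /=; rewrite shift_setD.
rewrite sumrB; apply/eqP; rewrite subr_eq0; apply/eqP.
rewrite [RHS](reindex_inj (addIr 1)) /=; apply: eq_bigr => c _.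
by rewrite -map_comp; congr G; apply: eq_map => A /=; rewrite shift_setD.
Qed.

Lemma hamming_shift (q N : nat) c (x y : {ffun 'I_N -> 'F_q}) :
  hamming (shift c x) (shift c y) = hamming x y.
Proof.
by apply: eq_card => j; rewrite !inE !ffunE (inj_eq (addIr c)).
Qed.

Lemma thin_shift (q N d : nat) c (s : seq {set {ffun 'I_N -> 'F_q}}) :
  thin d s -> thin d (map (shift_set c) s).
Proof.
case=> size_s sub_s thin_s; split; first by rewrite size_map.
  rewrite pairwise_map; apply: sub_pairwise sub_s => A B sAB; exact: imsetS.
move=> _ /mapP[A /thin_s[An0 diamA] ->]; split.
  by apply: contra An0; rewrite imset_eq0.
by move=> _ _ /imsetP[x Ax ->] /imsetP[y Ay ->]; rewrite hamming_shift diamA.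
Qed.

Lemma hamming_zero_below (q N i k l : nat) (x y : {ffun 'I_N -> 'F_q}) :
  (i <= k <= i.+1)%N -> (i <= l <= i.+1)%N ->
  (hamming (zero_below k x) (zero_below l y) <= (hamming x y).+1)%N.
Proof.
move=> /andP[ik ki] /andP[il li].
have sub : [set j | zero_below k x j != zero_below l y j] \subset
    [set j | x j != y j] :|: [set j : 'I_N | j == i :> nat].
  apply/subsetP => j; rewrite !inE !ffunE.
  have [->|ne_ji] := eqVneq (j : nat) i; first by rewrite orbT.
  have -> : (j < k)%N = (j < i)%N by lia.
  have -> : (j < l)%N = (j < i)%N by lia.
  by case: ifP; rewrite ?eqxx ?orbF.
rewrite (leq_trans (subset_leq_card sub)) // (leq_trans (leq_card_setU _ _)) //.
rewrite -[(hamming x y).+1]addn1 leq_add2l.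
case: (ltnP i N) => iN; last first.
  by rewrite eq_card0 // => j; rewrite !inE; have := ltn_ord j; lia.
by rewrite (eq_card (B := [set Ordinal iN])) ?cards1 // => j; rewrite !inE.
Qed.

Lemma thin_prism (q N d i k : nat) (s1 s2 : seq {set {ffun 'I_N -> 'F_q}}) A :
  (i <= k <= i.+1)%N -> thin d (s1 ++ A :: s2) ->
  thin d.+1 (map (zero_set k) (rcons s1 A) ++ map (zero_step i) (A :: s2)).
Proof.
move=> ik [size_s sub_s thin_s].
have stepP (B : {set {ffun 'I_N -> 'F_q}}) x : x \in zero_step i B ->
    exists l y, [/\ (i <= l <= i.+1)%N, y \in B & x = zero_below l y].
  by rewrite inE => /orP[] /imsetP[y By ->]; [exists i | exists i.+1]; exists y; split=> //; lia.
have sub_step (B : {set {ffun 'I_N -> 'F_q}}) : zero_set k B \subset zero_step i B.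
  rewrite /zero_step; have [->|->] : k = i \/ k = i.+1 by lia.
    exact: subsetUl.
  exact: subsetUr.
have mono_step (B C : {set {ffun 'I_N -> 'F_q}}) : B \subset C -> zero_step i B \subset zero_step i C.
  by move=> sBC; apply: setUSS; apply: imsetS.
move: sub_s; rewrite pairwise_cat pairwise_cons => /and3P[/allrelP s12 sub1 /andP[/allP sA2 sub2]].
split.
- by move: size_s; rewrite !(size_cat, size_map, size_rcons) /=; lia.
- rewrite pairwise_cat; apply/and3P; split.
  + apply/allrelP => _ _ /mapP[B sB ->] /mapP[C sC ->].
    apply: subset_trans (sub_step B) (mono_step _ _ _).
    move: sB sC; rewrite mem_rcons !inE => /orP[/eqP->|sB] /orP[/eqP->|sC] //.
    * exact: sA2.
    * by apply: s12; rewrite ?mem_head.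
    * by apply: s12; rewrite ?inE ?sC ?orbT.
  + rewrite pairwise_map pairwise_rcons; apply/andP; split.
      apply/allP => B sB; apply: imsetS; apply: s12 => //; exact: mem_head.
    by apply: sub_pairwise sub1 => B C; apply: imsetS.
  + rewrite pairwise_map pairwise_cons; apply/andP; split.
      by apply/allP => C sC; apply/mono_step/sA2.
    by apply: sub_pairwise sub2 => B C; apply: mono_step.
- move=> B; rewrite mem_cat => /orP[] /mapP[C sC ->].
    have {}sC : C \in s1 ++ A :: s2.
      by move: sC; rewrite mem_rcons mem_cat !inE => /orP[->|->]; rewrite ?orbT.
    have [Cn0 diamC] := thin_s _ sC; split; first by rewrite /zero_set imset_eq0.
    move=> _ _ /imsetP[x Cx ->] /imsetP[y Cy ->].
    by rewrite (leq_trans (hamming_zero_below (i := i) _ _ _ _)) // ltnS diamC.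
  have {}sC : C \in s1 ++ A :: s2 by rewrite mem_cat sC orbT.
  have [Cn0 diamC] := thin_s _ sC; split.
    by rewrite -subset0 subUset !subset0 /zero_set !imset_eq0 (negPf Cn0).
  move=> _ _ /stepP[l [x [il Cx ->]]] /stepP[m [y [im Cy ->]]].
  by rewrite (leq_trans (hamming_zero_below (i := i) _ _ _ _)) // ltnS diamC.
Qed.

Lemma eq_cycle_eval (q N d : nat) (G G' : seq {set {ffun 'I_N -> 'F_q}} -> 'F_q) :
  (forall s, thin d s -> G s = G' s) -> cycle_eval d G = cycle_eval d G'.
Proof.
elim: d G G' => [|d IHd] G G' eqG /=.
  apply: eqG; split=> // A; rewrite inE => /eqP->; split.
    by apply/set0Pn; exists [ffun=> 0]; rewrite inE.
  move=> x y /set1P-> /set1P->; rewrite leqn0 cards_eq0.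
  by apply/eqP/setP => j; rewrite !inE eqxx.
apply: IHd => s thin_s.
have E t : thin d t -> contraction G t = contraction G' t.
  move=> thin_t; apply: eq_bigr => i _; congr (_ - _); apply: eq_prism => s1 A s2 eqt;
  by apply: eqG; apply: thin_prism; rewrite -?eqt //; lia.
rewrite /periodic_op; case: ifP => _; first by rewrite !E //; apply: thin_shift.
by apply: eq_bigr => c _; apply: E; apply: thin_shift.
Qed.

Lemma cycle_evalB (q N d : nat) (G G' : seq {set {ffun 'I_N -> 'F_q}} -> 'F_q) :
  cycle_eval d (fun s => G s - G' s) = cycle_eval d G - cycle_eval d G'.
Proof.
elim: d G G' => [|d IHd] G G' //=; rewrite -IHd; apply: eq_cycle_eval => s _.
have E t : contraction (fun s => G s - G' s) t = contraction G t - contraction G' t.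
  by rewrite /contraction -sumrB; apply: eq_bigr => i _; rewrite !prismB; ring.
rewrite /periodic_op; case: ifP => _; first by rewrite !E; ring.
by rewrite -sumrB; apply: eq_bigr => c _.
Qed.

Lemma cycle_eval0 (q N d : nat) (G : seq {set {ffun 'I_N -> 'F_q}} -> 'F_q) :
  (forall s, thin d s -> G s = 0) -> cycle_eval d G = 0.
Proof.
move=> G0; rewrite -(subrr (cycle_eval d G)) -cycle_evalB.
by apply: eq_cycle_eval => s /G0 ->; rewrite subr0.
Qed.

Lemma zero_set_full (q N : nat) (A : {set {ffun 'I_N -> 'F_q}}) :
  A != set0 -> zero_set N A = [set [ffun=> 0]].
Proof.
case/set0Pn => x Ax; apply/setP => y; rewrite inE; apply/imsetP/eqP.
  by case=> z _ ->; apply/ffunP => j; rewrite !ffunE ltn_ord.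
by move=> ->; exists x => //; apply/ffunP => j; rewrite !ffunE ltn_ord.
Qed.

(** Stokes' formula. Moving the coboundary through [contraction] leaves [- G], a constant, which
    [periodic_op] kills, and a coboundary, which the induction turns into two consecutive
    [periodic_op], whose composite is 0. *)
Lemma cycle_eval_coboundary (q N d : nat) (G : seq {set {ffun 'I_N -> 'F_q}} -> 'F_q) :
  prime q -> cycle_eval d.+1 (coboundary G) = - cycle_eval d (periodic_op d G).
Proof.
move=> pr_q; elim: d G => [|d IHd] G.
  rewrite /= /periodic_op /=; apply/eqP; rewrite -addr_eq0 -big_split /=.
  pose z : {set {ffun 'I_N -> 'F_q}} := [set [ffun=> 0]].
  (* All translates of the vertex contract to the origin and give the same value, taken [q] times in
     characteristic [q]. *)
  rewrite (eq_bigr (fun=> G [:: z])) => [|c _].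
    by rewrite sumr_const card_Fp // -mulr_natr pchar_Fp_0 // mulr0.
  have := contraction_homotopy G [:: shift_set c z].
  rewrite coboundary_cons [contraction G [::]]big1 => [|i _]; last by rewrite /= subr0.
  rewrite [map _ _]/= zero_set_full ?imset_eq0; last first.
    by apply/set0Pn; exists [ffun=> 0]; rewrite inE.
  by rewrite -/z subr0 addr0 => ->; rewrite subrK.
pose e := d.+1; rewrite -/e -[LHS]/(cycle_eval e (periodic_op e (contraction (coboundary G)))).
have full (t : seq {set {ffun 'I_N -> 'F_q}}) :
    thin e t -> map (zero_set N) t = nseq e.+1 [set [ffun=> 0]].
  case=> size_t _ thin_t; rewrite -size_t -(size_map (zero_set N) t).
  apply/all_pred1P/allP => _ /mapP[A /thin_t[An0 _] ->] /=.
  by rewrite zero_set_full.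
pose K := G (nseq e.+1 [set [ffun=> 0]]).
have eqP' s : thin e s -> periodic_op e (contraction (coboundary G)) s =
    0 - periodic_op e (coboundary (contraction G)) s - periodic_op e G s.
  move=> thin_s.
  have E t : thin e t -> contraction (coboundary G) t =
      K - coboundary (contraction G) t - G t.
    move=> thin_t; have := contraction_homotopy G t; rewrite full // -/K.
    by move/(canRL (addrK _)) => ->; ring.
  rewrite /periodic_op; case: ifP => _.
    by rewrite !E //; [ring | apply: thin_shift].
  rewrite (eq_bigr (fun c => K - coboundary (contraction G) (map (shift_set c) s)
     - G (map (shift_set c) s))) => [|c _]; last exact/E/thin_shift.
  by rewrite !sumrB sumr_const card_Fp // -mulr_natr pchar_Fp_0 // mulr0.
rewrite (eq_cycle_eval eqP') !cycle_evalB [cycle_eval e (fun=> 0)]cycle_eval0 //.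
suff -> : cycle_eval e (periodic_op e (coboundary (contraction G))) = 0.
  by rewrite subrr sub0r.
rewrite (eq_cycle_eval (G' := coboundary (periodic_op e (contraction G)))); last first.
  by move=> s _; rewrite coboundary_periodic_op.
rewrite IHd cycle_eval0 ?oppr0 // => s _; exact: periodic_op_periodic_op.
Qed.

(** * Labels of small sets derived from a colouring *)

Definition color_shifts (q N n : nat) (lam : {ffun 'I_N -> 'F_q} -> 'I_n) (m : nat)
    (A : {set {ffun 'I_N -> 'F_q}}) : {set 'F_q} :=
  [set c | [exists x in A, lam (shift (- c) x) == m :> nat]].

Definition least_color (q N n : nat) (lam : {ffun 'I_N -> 'F_q} -> 'I_n)
    (A : {set {ffun 'I_N -> 'F_q}}) : nat :=
  find (fun m => color_shifts lam m A != set0) (iota 0 n).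

Definition least_shifts (q N n : nat) (lam : {ffun 'I_N -> 'F_q} -> 'I_n)
    (A : {set {ffun 'I_N -> 'F_q}}) : {set 'F_q} :=
  color_shifts lam (least_color lam A) A.

Definition label (q N n : nat) (lam : {ffun 'I_N -> 'F_q} -> 'I_n)
    (A : {set {ffun 'I_N -> 'F_q}}) : 'F_q :=
  (\sum_(c in least_shifts lam A) c) / #|least_shifts lam A|%:R.

(* Along an increasing chain of small sets the pair (least colour, number of shifts realising
   it) moves monotonically, which bounds the length of chains with changing labels. *)
Definition rank (q N n : nat) (lam : {ffun 'I_N -> 'F_q} -> 'I_n)
    (A : {set {ffun 'I_N -> 'F_q}}) : nat :=
  (least_color lam A * q + (q - #|least_shifts lam A|))%N.

Lemma color_shiftsS (q N n m : nat) (lam : {ffun 'I_N -> 'F_q} -> 'I_n)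
    (A B : {set {ffun 'I_N -> 'F_q}}) :
  A \subset B -> color_shifts lam m A \subset color_shifts lam m B.
Proof.
move=> /subsetP sAB; apply/subsetP => c; rewrite !inE => /exists_inP[x Ax lx].
by apply/exists_inP; exists x => //; apply: sAB.
Qed.

Lemma least_color_spec (q N n : nat) (lam : {ffun 'I_N -> 'F_q} -> 'I_n) A :
  A != set0 -> (least_color lam A < n)%N /\ least_shifts lam A != set0.
Proof.
case/set0Pn => x Ax.
have hasP : has (fun m => color_shifts lam m A != set0) (iota 0 n).
  apply/hasP; exists (val (lam x)); first by rewrite mem_iota ltn_ord.
  apply/set0Pn; exists 0; rewrite inE; apply/exists_inP; exists x => //.
  have -> : shift (- 0) x = x by apply/ffunP => j; rewrite ffunE oppr0 addr0.
  by [].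
have lt_n : (least_color lam A < n)%N.
  by move: hasP; rewrite has_find size_iota.
by split=> //; have := nth_find 0%N hasP; rewrite nth_iota.
Qed.

Lemma least_color_min (q N n m : nat) (lam : {ffun 'I_N -> 'F_q} -> 'I_n) A :
  (m < n)%N -> color_shifts lam m A != set0 -> (least_color lam A <= m)%N.
Proof.
move=> lt_m; apply: contraTT; rewrite -ltnNge => lt_mM.
by have := before_find 0%N lt_mM; rewrite nth_iota // add0n => ->.
Qed.

(** The sign in [shift (- c)] is chosen for this equivariance, which makes the least colour
    invariant. *)
Lemma color_shifts_shift (q N n m : nat) (lam : {ffun 'I_N -> 'F_q} -> 'I_n) c A :
  color_shifts lam m (shift_set c A) = [set e + c | e in color_shifts lam m A].
Proof.
apply/setP => e; rewrite !inE; apply/exists_inP/imsetP.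
  case=> _ /imsetP[x Ax ->] lx; exists (e - c); last by rewrite subrK.
  rewrite inE; apply/exists_inP; exists x => //.
  move: lx; congr (nat_of_ord (lam _) == m); apply/ffunP => j; rewrite !ffunE; ring.
case=> f; rewrite inE => /exists_inP[x Ax lx] ->; exists (shift c x); first exact: imset_f.
move: lx; congr (nat_of_ord (lam _) == m); apply/ffunP => j; rewrite !ffunE; ring.
Qed.

Lemma least_color_shift (q N n : nat) (lam : {ffun 'I_N -> 'F_q} -> 'I_n) c A :
  least_color lam (shift_set c A) = least_color lam A.
Proof. by apply: eq_find => m; rewrite color_shifts_shift imset_eq0. Qed.

Lemma least_shifts_shift (q N n : nat) (lam : {ffun 'I_N -> 'F_q} -> 'I_n) c A :
  least_shifts lam (shift_set c A) = [set e + c | e in least_shifts lam A].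
Proof. by rewrite /least_shifts least_color_shift color_shifts_shift. Qed.

(* The mean of a set of residues is shift-equivariant only because its cardinal, being
   smaller than [q], is invertible. *)
Lemma label_shift (q N n : nat) (lam : {ffun 'I_N -> 'F_q} -> 'I_n) c A :
  prime q -> (0 < #|least_shifts lam A| < q)%N ->
  label lam (shift_set c A) = label lam A + c.
Proof.
move=> pr_q /andP[card_gt0 card_lt]; rewrite /label least_shifts_shift.
have inj : injective (fun e : 'F_q => e + c) by apply: addIr.
rewrite card_imset // big_imset /=; last by move=> e f _ _; apply: inj.
rewrite big_split /= sumr_const mulrDl; congr (_ + _).
rewrite -[c *+ _]mulr_natr mulfK // -(dvdn_pcharf (pchar_Fp pr_q)).
by rewrite gtnNdvd.
Qed.

Lemma rank_anti (q N n : nat) (lam : {ffun 'I_N -> 'F_q} -> 'I_n)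
    (A B : {set {ffun 'I_N -> 'F_q}}) :
  A \subset B -> (0 < #|least_shifts lam A| < q)%N ->
  (0 < #|least_shifts lam B| < q)%N -> A != set0 ->
  (rank lam B < rank lam A)%N \/ label lam A = label lam B.
Proof.
move=> sAB /andP[gA ltA] /andP[gB ltB] An0.
have [ltn An0'] := least_color_spec lam An0.
have leM : (least_color lam B <= least_color lam A)%N.
  apply: least_color_min ltn _; apply: contra An0'; rewrite -!subset0.
  exact/subset_trans/color_shiftsS.
(* When the least colour drops, the second summand of the rank, between 1 and [q - 1], cannot make
   up for the loss of [q]. *)
rewrite /rank; move: leM; rewrite leq_eqVlt => /orP[/eqP eqM | ltM]; last first.
  left; move: ltM gA gB ltA ltB; set u := least_color _ _; set v := least_color _ _.
  move=> ltM gA gB ltA ltB.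
  have : (u.+1 * q <= v * q)%N by rewrite leq_mul2r ltM orbT.
  rewrite mulSn; lia.
have sub : least_shifts lam A \subset least_shifts lam B.
  by rewrite /least_shifts eqM; apply: color_shiftsS.
have [eqc | nec] := eqVneq #|least_shifts lam A| #|least_shifts lam B|.
  right; suff eqW : least_shifts lam A = least_shifts lam B by rewrite /label eqW.
  by apply/eqP; rewrite eqEcard sub eqc leqnn.
by left; rewrite eqM ltn_add2l; have := subset_leq_card sub; lia.
Qed.

(** Without such a pair the labels are equivariant on thin chains, and the cochains [fan] pulled
    back along them pair to a unit with the periodic chains up to degree [n * q]. In that degree
    there are too few ranks for the labels to change at every step of a chain, so the pairing is
    also 0. *)
Theorem shifted_coloring (q N n : nat) (lam : {ffun 'I_N -> 'F_q} -> 'I_n) :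
  prime q ->
  exists x y, lam x = lam y /\ (hamming (shift 1%R x) y <= n * q)%N.
Proof.
move=> pr_q; pose D := (n * q)%N.
have [/existsP[x /existsP[y /andP[/eqP]]]|] :=
  boolP [exists x, exists y, (lam x == lam y) && (hamming (shift 1%R x) y <= n * q)%N].
  by exists x, y.
move/existsPn => no; exfalso.
have {}no x y : (hamming (shift 1%R x) y <= D)%N -> lam x <> lam y.
  move=> le_xy eq_xy; have /existsPn/(_ y) := no x.
  by rewrite eq_xy eqxx le_xy.
(* If every shift were realised, the shifts 0 and 1 would provide two points of one colour, one of
   them close to the other translated by 1. *)
have proper (A : {set {ffun 'I_N -> 'F_q}}) : A != set0 ->
    {in A &, forall x y, (hamming x y <= D)%N} -> (0 < #|least_shifts lam A| < q)%N.
  move=> An0 diamA; have [_ n0] := least_color_spec lam An0.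
  rewrite card_gt0 n0 /=; have := max_card (mem (least_shifts lam A)).
  rewrite card_Fp // leq_eqVlt => /orP[/eqP full|//].
  have {}full : least_shifts lam A = setT.
    by apply/eqP; rewrite eqEcard subsetT cardsT card_Fp // [X in (_ <= X)%N]full leqnn.
  have: 0 \in least_shifts lam A by rewrite full inE.
  rewrite inE => /exists_inP[x Ax /eqP lx].
  have: 1 \in least_shifts lam A by rewrite full inE.
  rewrite inE => /exists_inP[y Ay /eqP ly].
  case: (no (shift (- 1) y) (shift (- 0) x)); last by apply: val_inj; rewrite /= ly lx.
  have -> : shift 1 (shift (- 1) y) = y by apply/ffunP => j; rewrite !ffunE subrK.
  have -> : shift (- 0) x = x by apply/ffunP => j; rewrite !ffunE oppr0 addr0.
  exact: diamA.
have equiv d s c : (d <= D)%N -> thin d s ->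
    map (label lam) (map (shift_set c) s) = map (fun a => a + c) (map (label lam) s).
  move=> le_d [_ _ thin_s]; rewrite -!map_comp; apply/eq_in_map => A /thin_s[An0 diamA] /=.
  by rewrite label_shift // proper // => x y Ax Ay; apply: leq_trans le_d; apply: diamA.
pose F d (s : seq {set {ffun 'I_N -> 'F_q}}) := fan d (map (label lam) s).
(* In degree 0 exactly one translate of the origin has label -1. Stokes' formula and the
   coboundaries of [fan] then raise the degree, with one sign each time. *)
have chain d : (d <= D)%N -> cycle_eval d (periodic_op d (F d)) = (-1) ^+ d.
  elim: d => [|d IHd] le_d.
    rewrite expr0 /= /periodic_op /=.
    have thin0 : thin 0 [:: [set [ffun=> 0]] : {set {ffun 'I_N -> 'F_q}}].
      split=> // A; rewrite inE => /eqP->; split.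
        by apply/set0Pn; exists [ffun=> 0]; rewrite inE.
      move=> x y /set1P-> /set1P->; rewrite leqn0 cards_eq0.
      by apply/eqP/setP => j; rewrite !inE eqxx.
    set b := label lam [set [ffun=> 0]].
    have E c : label lam (shift_set c [set [ffun=> 0]]) = b + c.
      exact: (congr1 (head 0) (equiv 0%N _ c le_d thin0)).
    rewrite (bigD1 (- 1 - b)) //= /F /= fan_even // E addrCA subrr addr0 eqxx mul1r.
    rewrite big1 ?addr0 // => c nc; rewrite fan_even // E.
    suff /negPf-> : b + c != -1 by rewrite mul0r.
    by apply: contra nc => /eqP <-; rewrite addrC addKr.
  rewrite exprS -IHd 1?ltnW // mulN1r -cycle_eval_coboundary //.
  apply: eq_cycle_eval => s thin_s; rewrite /F coboundary_map.
  have size_s : size (map (label lam) s) = d.+2 by rewrite size_map; case: thin_s.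
  rewrite /periodic_op /=; case: (boolP (odd d)) => odd_d /=; last first.
    by rewrite coboundary_fan_even // (equiv _ _ _ le_d thin_s).
  rewrite coboundary_fan_odd //.
  rewrite (eq_bigr (fun c => fan d.+1 (map (fun a => a + c) (map (label lam) s)))); last first.
    by move=> c _; rewrite (equiv _ _ _ le_d thin_s).
  case: (map _ s) size_s => // a l _.
  rewrite (eq_bigr (fun c => (a + c == -1)%:R * carries (a :: l))) => [|c _].
    rewrite -mulr_suml (bigD1 (- 1 - a)) //= addrCA subrr addr0 eqxx.
    rewrite big1 ?addr0 ?mul1r // => c nc.
    suff /negPf-> : a + c != -1 by [].
    by apply: contra nc => /eqP <-; rewrite addrC addKr.
  by rewrite [map _ _]/= fan_even ?negbK // -[_ :: map _ _]/(map (fun b => b + c) (a :: l)) carriesD.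
(* If all neighbouring labels differed, the [D + 1] sets of the chain would have strictly decreasing
   ranks below [D]. *)
have top s : thin D s -> F D s = 0.
  move=> thin_s; apply: fan_eq0; first by rewrite size_map; case: thin_s.
  case: thin_s => size_s sub_s thin_s.
  apply/negP => srt.
  have card_s A : A \in s -> (0 < #|least_shifts lam A| < q)%N.
    by move=> sA; have [An0 diamA] := thin_s A sA; apply: proper.
  have desc : sorted (fun A B => rank lam B < rank lam A)%N s.
    move: sub_s {size_s} thin_s srt card_s; elim: s => // A [|B s] IHs // /andP[/andP[sAB _] sub_s].
    move=> thin_s /andP[neq srt] card_s.
    have thin_s' C : C \in B :: s -> C \in [:: A, B & s] by move=> sC; rewrite inE sC orbT.
    rewrite /=; apply/andP; split; last first.
      by apply: IHs => // C sC; [apply: thin_s | apply: card_s]; apply: thin_s'.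
    case: (@rank_anti _ _ _ lam A B) => //.
    - by apply: card_s; rewrite mem_head.
    - by apply/card_s/thin_s'/mem_head.
    - by have [] := thin_s A (mem_head _ _).
    - by move=> eqL; rewrite eqL eqxx in neq.
  have uniq_s : uniq (map (rank lam) s).
    apply: (sorted_uniq (leT := fun u v : nat => v < u)%N) => [u v w | u |].
    - by move=> /[swap]; apply: ltn_trans.
    - exact: ltnn.
    - by rewrite sorted_map.
  (* The rank is at most [(n - 1) * q + (q - 1)], because at least one shift realises the least
     colour. *)
  have sub : {subset map (rank lam) s <= iota 0 D}.
    move=> _ /mapP[A sA ->]; rewrite mem_iota add0n leq0n /=.
    have [An0 _] := thin_s A sA; have [ltM _] := least_color_spec lam An0.
    have /andP[cA _] := card_s A sA; have := leq_mul2r q (least_color lam A).+1 n.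
    rewrite ltM orbT mulSn /rank /D; have := prime_gt0 pr_q; lia.
  by have := uniq_leq_size uniq_s sub; rewrite size_map size_iota size_s ltnn.
have := chain D (leqnn D); rewrite cycle_eval0 => [/esym/eqP|s thin_s].
  by rewrite signr_eq0.
rewrite /periodic_op !top ?subrr; try exact: thin_shift; last by [].
by rewrite big1 ?if_same // => c _; apply/top/thin_shift.
Qed.

(** * A dense set avoiding near-shifts *)

Lemma sum_ffun_recl (T : finType) (R : nmodType) (V : nmodType) (N : nat)
    (g : T -> V) (F : V -> R) :
  \sum_(x : {ffun 'I_N.+1 -> T}) F (\sum_j g (x j)) =
  \sum_(b : T) \sum_(x : {ffun 'I_N -> T}) F (g b + \sum_j g (x j)).
Proof.
pose cons (p : T * {ffun 'I_N -> T}) : {ffun 'I_N.+1 -> T} :=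
  [ffun j => if unlift ord0 j is Some i then p.2 i else p.1].
pose uncons (x : {ffun 'I_N.+1 -> T}) := (x ord0, [ffun i => x (lift ord0 i)]).
rewrite (reindex cons) /=; last first.
  exists uncons => [[b x] _ | x _].
    rewrite /uncons /cons ffunE unlift_none; congr (_, _).
    by apply/ffunP => i; rewrite !ffunE liftK.
  by apply/ffunP => j; rewrite ffunE; case: unliftP => [i|] -> //=; rewrite ffunE.
rewrite pair_big /=; apply: eq_bigr => -[b x] _; congr F.
rewrite big_ord_recl ffunE unlift_none /=; congr (_ + _).
by apply: eq_bigr => i _; rewrite ffunE liftK.
Qed.

(** A statistic of mean 0 that changes sign under the reflection [b -> 1 - b]; this makes the two
    tails of [tilt] equal. *)
Definition bias (q : nat) (b : 'F_q) : int := (b == 0)%:Z - (b == 1)%:Z.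

Definition tilt (q N : nat) (x : {ffun 'I_N -> 'F_q}) : int := \sum_j bias (x j).

Lemma sum_bias (q : nat) (h : int -> int) :
  prime q -> \sum_(b : 'F_q) h (bias b) = h 1 + h (-1) + (q%:Z - 2) * h 0.
Proof.
move=> pr_q; rewrite (bigD1 0) //= (bigD1 1) ?oner_eq0 //=.
rewrite addrA; congr (_ + _).
rewrite (eq_bigr (fun=> h 0)) => [|b /andP[/negPf b0 /negPf b1]]; last first.
  by rewrite /bias b0 b1.
rewrite sumr_const -[LHS]mulr_natl; congr (_ * _).
have := cardC (pred2 (0 : 'F_q) 1); rewrite card_Fp // card2 eq_sym oner_eq0 /=.
rewrite (eq_card (B := fun b : 'F_q => (b != 0) && (b != 1))); last first.
  by move=> b; rewrite !inE negb_or.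
move=> card_q; apply/eqP; rewrite natz eq_sym subr_eq -PoszD eqz_nat addnC.
by apply/eqP; rewrite -[LHS]card_q; congr (_ + _)%N; apply: eq_card.
Qed.

Lemma tilt_moment2 (q N : nat) : prime q ->
  q%:Z * (\sum_(x : {ffun 'I_N -> 'F_q}) tilt x ^+ 2) = 2 * N%:Z * q%:Z ^+ N.
Proof.
move=> pr_q; elim: N => [|N IHN].
  rewrite big1 ?mulr0 // => x _; by rewrite /tilt big_ord0.
rewrite /tilt (sum_ffun_recl N (@bias q) (fun w => w ^+ 2)) exchange_big /=.
rewrite (eq_bigr (fun x => q%:Z * tilt x ^+ 2 + 2)) => [|x _]; last first.
  by rewrite (sum_bias (fun b => (b + tilt x) ^+ 2)) //; ring.
rewrite big_split /= -mulr_sumr IHN sumr_const card_ffun card_Fp // card_ord.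
by rewrite -[2 *+ _]mulr_natl natrX exprS -!natz; ring.
Qed.

(** After division by [q ^ (N + 2)] the terms are the [N] fourth moments [2 / q] of [bias] and
    [3 N (N - 1)] products of two variances [2 / q]. *)
Lemma tilt_moment4 (q N : nat) : prime q ->
  q%:Z ^+ 2 * (\sum_(x : {ffun 'I_N -> 'F_q}) tilt x ^+ 4) =
  (2 * q%:Z * N%:Z + 12 * N%:Z * (N%:Z - 1)) * q%:Z ^+ N.
Proof.
move=> pr_q; elim: N => [|N IHN].
  by rewrite big1 ?mulr0 ?mul0r ?addr0 ?mul0r // => x _; rewrite /tilt big_ord0.
rewrite /tilt (sum_ffun_recl N (@bias q) (fun w => w ^+ 4)) exchange_big /=.
rewrite (eq_bigr (fun x => q%:Z * tilt x ^+ 4 + 12 * tilt x ^+ 2 + 2)) => [|x _]; last first.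
  by rewrite (sum_bias (fun b => (b + tilt x) ^+ 4)) //; ring.
rewrite !big_split /= -!mulr_sumr sumr_const card_ffun card_Fp // card_ord.
rewrite natrX -!natz.
have := tilt_moment2 N pr_q; rewrite -!natz in IHN *.
set S4 := \sum_x _ ^+ 4 in IHN *; set S2 := \sum_x _ ^+ 2 => E2.
have -> : q%:R ^+ 2 * (q%:R * S4 + 12 * S2 + (q%:R ^+ N + q%:R ^+ N)) =
    q%:R * (q%:R ^+ 2 * S4) + 12 * q%:R * (q%:R * S2) + q%:R ^+ N * 2 * q%:R ^+ 2 by ring.
rewrite IHN E2 [_ ^+ N.+1]exprS -[N.+1%:R]natr1; ring.
Qed.

(* Paley-Zygmund: the second and fourth moments force [|tilt|] to be large often. *)
Lemma tilt_large (q N T : nat) : prime q -> (0 < T)%N -> (4 * q * T ^ 2 + q <= N)%N ->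
  (q ^ N <= 16 * #|[set x : {ffun 'I_N -> 'F_q} | (T%:Z <= tilt x)%R]|)%N.
Proof.
move=> pr_q T_gt0 le_N.
pose big (x : {ffun 'I_N -> 'F_q}) : bool := T%:Z <= `|tilt x|.
(* A linear form of Paley-Zygmund: where [|tilt x|] reaches [T] this is [(q m^2 - 4 N)^2 >= 0] with
   [m = tilt x], and [4 N / q] is twice the mean of [m^2]. *)
have point (x : {ffun 'I_N -> 'F_q}) :
   8 * N%:Z * q%:Z * tilt x ^+ 2 <=
   8 * N%:Z * q%:Z * T%:Z ^+ 2 + 16 * N%:Z ^+ 2 * (big x)%:Z + q%:Z ^+ 2 * tilt x ^+ 4.
  rewrite /big; case: (leP T%:Z) => hT /=.
    have : 0 <= 8 * N%:Z * q%:Z * T%:Z ^+ 2 by rewrite !mulr_ge0 ?exprn_ge0.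
    have := sqr_ge0 (q%:Z * tilt x ^+ 2 - 4 * N%:Z); nia.
  rewrite mulr0 addr0; apply: ler_wpDr; first by rewrite mulr_ge0 // exprn_even_ge0.
  rewrite ler_wpM2l ?mulr_ge0 // -[X in X <= _]real_normK ?num_real //.
  by rewrite ler_pXn2r ?nnegrE // ltW.
have : \sum_(x : {ffun 'I_N -> 'F_q}) (8 * N%:Z * q%:Z * tilt x ^+ 2) <=
    \sum_(x : {ffun 'I_N -> 'F_q}) (8 * N%:Z * q%:Z * T%:Z ^+ 2 +
      16 * N%:Z ^+ 2 * (big x)%:Z + q%:Z ^+ 2 * tilt x ^+ 4).
  by apply: ler_sum => x _; apply: point.
rewrite big_split big_split /= -!mulr_sumr sumr_const card_ffun card_Fp // card_ord.
rewrite tilt_moment4 // -[8 * _ * _ * _]mulrA tilt_moment2 //.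
pose P := #|[set x : {ffun 'I_N -> 'F_q} | T%:Z <= tilt x]|.
have -> : \sum_(x : {ffun 'I_N -> 'F_q}) (big x)%:Z = P%:Z + P%:Z.
  have opp (x : {ffun 'I_N -> 'F_q}) : tilt [ffun j => 1 - x j] = - tilt x.
    rewrite /tilt -sumrN; apply: eq_bigr => j _; rewrite ffunE /bias opprB.
    have -> : (1 - x j == 0) = (x j == 1) by rewrite subr_eq0 eq_sym.
    by have -> : (1 - x j == 1) = (x j == 0) by rewrite -subr_eq0 addrAC subrr add0r oppr_eq0.
  have cardP : \sum_(x : {ffun 'I_N -> 'F_q}) (T%:Z <= tilt x)%R%:Z = P%:Z.
    rewrite -[RHS]natz /P -sum1dep_card natr_sum [RHS]big_mkcond /=.
    by apply: eq_bigr => x _; case: ifP.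
  have cardN : \sum_(x : {ffun 'I_N -> 'F_q}) (T%:Z <= - tilt x)%R%:Z = P%:Z.
    rewrite -cardP [RHS](reindex_inj (h := fun x : {ffun 'I_N -> 'F_q} => [ffun j => 1 - x j])) /=.
      by apply: eq_bigr => x _; rewrite opp.
    move=> x y /ffunP eqxy; apply/ffunP => j; have := eqxy j; rewrite !ffunE.
    by move/addrI/oppr_inj.
  rewrite -{1}cardP -cardN -big_split; apply: eq_bigr => x _ /=; rewrite /big.
  have := T_gt0; move: (tilt x) => m; lia.
rewrite -[_ *+ (q ^ N)]mulr_natl natrX [q%:R]natz.
have qN_gt0 : 0 < q%:Z ^+ N by rewrite exprn_gt0 // ltz_nat prime_gt0.
have N_gt0 : (0 < N)%N by have := prime_gt0 pr_q; lia.
move=> H; suff : q%:Z ^+ N <= 16 * P%:Z.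
  rewrite (_ : q%:Z ^+ N = (q ^ N)%N%:Z); last by rewrite -!natz natrX.
  by rewrite -PoszM lez_nat.
have {}le_N : 4 * q%:Z * T%:Z ^+ 2 + q%:Z <= N%:Z by lia.
rewrite -(ler_pM2l (_ : 0 < 2 * N%:Z ^+ 2)); last by rewrite mulr_gt0 // exprn_gt0.
move: qN_gt0 H le_N; set Q := q%:Z ^+ N; move: Q => Q Q_gt0 H le_N.
have : 2 * N%:Z * Q * (4 * q%:Z * T%:Z ^+ 2 + q%:Z) <= 2 * N%:Z * Q * N%:Z.
  by rewrite ler_wpM2l // !mulr_ge0 // ltW.
have : 0 <= N%:Z * Q by rewrite mulr_ge0 // ltW.
lra.
Qed.

Lemma bias_diff (q : nat) (a b : 'F_q) : `|bias a - bias b| <= 2 * (a != b)%:Z.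
Proof.
have [->|_] := eqVneq; first by rewrite subrr normr0.
by rewrite /bias; do !case: eqP => _.
Qed.

Lemma tilt_diff (q N : nat) (x y : {ffun 'I_N -> 'F_q}) :
  `|tilt x - tilt y| <= 2 * (hamming x y)%:Z.
Proof.
rewrite /tilt -sumrB; apply: le_trans (ler_norm_sum _ _ _) _.
rewrite /hamming -sum1dep_card -[X in 2 * X]natz natr_sum [leRHS]mulr_sumr [leRHS]big_mkcond /=.
by apply: ler_sum => j _; have := bias_diff (x j) (y j); case: ifP.
Qed.

Lemma shiftD (q N : nat) (c e : 'F_q) (x : {ffun 'I_N -> 'F_q}) :
  shift c (shift e x) = shift (e + c) x.
Proof. by apply/ffunP => j; rewrite !ffunE addrA. Qed.

Lemma shift_inj (q N : nat) (c : 'F_q) : injective (@shift q N c).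
Proof. by move=> x y /ffunP e; apply/ffunP => j; have := e j; rewrite !ffunE => /addIr. Qed.

(** Along the orbit each coordinate runs once through all residues, on which [bias] sums to 0. *)
Lemma sum_tilt_shift (q N : nat) (x : {ffun 'I_N -> 'F_q}) (psi : 'F_q) :
  prime q -> psi != 0 -> \sum_(c : 'F_q) tilt (shift (c * psi) x) = 0.
Proof.
move=> pr_q psi0; rewrite /tilt exchange_big /= big1 // => j _.
rewrite (eq_bigr (fun c : 'F_q => bias (x j + c * psi))) => [|c _]; last by rewrite ffunE.
rewrite -(reindex (fun c : 'F_q => x j + c * psi) (P := xpredT) (F := @bias q)); last first.
  apply: onW_bij; apply: injF_bij => c e /addrI; exact: mulIf.
by rewrite (sum_bias id) //; ring.
Qed.

(* Walking along the orbit of [x] under [psi], the tilt starts above [q * K] and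
   cannot stay positive, so it must drop by [K] across some level in a single step. *)
Lemma tilt_drop (q N K : nat) (psi : 'F_q) (x : {ffun 'I_N -> 'F_q}) :
  prime q -> psi != 0 -> (0 < K)%N -> (q * K)%N%:Z <= tilt x ->
  exists (c : 'F_q) (l : 'I_q), (l.+1 * K)%N%:Z <= tilt (shift (c * psi) x) /\
    tilt (shift psi (shift (c * psi) x)) <= (l * K)%N%:Z.
Proof.
move=> pr_q psi0 K_gt0 large.
have [/existsP[c /existsP[l /andP[]]]|no] := boolP [exists c : 'F_q, exists l : 'I_q,
   ((l.+1 * K)%N%:Z <= tilt (shift (c * psi) x)) &&
   (tilt (shift psi (shift (c * psi) x)) <= (l * K)%N%:Z)].
  by exists c, l.
have stay i : (i < q)%N -> ((q - i) * K)%N%:Z <= tilt (shift (i%:R * psi) x).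
  elim: i => [|i IHi] lt_i.
    rewrite mul0r (_ : shift 0 x = x) ?subn0 //.
    by apply/ffunP => j; rewrite ffunE addr0.
  have lt_l : (q - i.+1 < q)%N by lia.
  have {}IHi := IHi (ltnW lt_i).
  have /existsPn/(_ (Ordinal lt_l)) := existsPn no i%:R.
  rewrite /= (_ : (q - i.+1).+1 = q - i)%N; last by lia.
  rewrite IHi /= -ltNge shiftD => /ltW.
  by rewrite (_ : i%:R * psi + psi = i.+1%:R * psi) // -natr1 mulrDl mul1r.
have Hq : (Zp_trunc (pdiv q)).+2 = q by exact: Fp_cast.
have lt_c (c : 'F_q) : (c < q)%N by rewrite -[X in (_ < X)%N]Hq ltn_ord.
have pos : 0 < \sum_(c : 'F_q) tilt (shift (c * psi) x).
  have tail_ge0 (c : 'F_q) : 0 <= tilt (shift (c * psi) x).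
    by have := stay c (lt_c c); rewrite natr_Zp; apply: le_trans.
  rewrite (bigD1 0) //=; apply: ltr_wpDr; first exact: sumr_ge0.
  have := stay 0%N (prime_gt0 pr_q); apply: lt_le_trans.
  by rewrite ltz_nat subn0 muln_gt0 prime_gt0.
by rewrite sum_tilt_shift ?ltxx in pos.
Qed.

(** Points of [D l] have tilt at least [(l + 1) L] and their translates by [psi] at most [l L],
    while changing [K] coordinates moves the tilt by at most [2 K < L]. By [tilt_drop] each point of
    large tilt has one of [q] translates in one of the [q] sets [D l], whence the loss [q ^ 2]. *)
Lemma dense_shift_avoiding (q K : nat) (psi : 'F_q) : prime q -> psi != 0 ->
  exists N0, forall N, (N0 <= N)%N -> exists D : {set {ffun 'I_N -> 'F_q}},
    (q ^ N <= 16 * q ^ 2 * #|D|)%N /\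
    {in D &, forall x y, (K < hamming (shift psi x) y)%N}.
Proof.
move=> pr_q psi0; pose L := (2 * K).+1; pose T := (q * L)%N.
exists (4 * q * T ^ 2 + q)%N => N le_N.
pose D (l : 'I_q) := [set x : {ffun 'I_N -> 'F_q} |
  ((l.+1 * L)%N%:Z <= tilt x)%R && (tilt (shift psi x) <= (l * L)%N%:Z)%R].
have [l large] : exists l, (q ^ N <= 16 * q ^ 2 * #|D l|)%N.
  apply/existsP; apply: contraT => /existsPn small.
  have T_gt0 : (0 < T)%N by rewrite muln_gt0 prime_gt0.
  have := tilt_large pr_q T_gt0 le_N.
  have bound : (#|[set x : {ffun 'I_N -> 'F_q} | (T%:Z <= tilt x)%R]| <= q * \sum_l #|D l|)%N.
    rewrite -sum1dep_card big_mkcond /=.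
    apply: (@leq_trans (\sum_(x : {ffun 'I_N -> 'F_q}) \sum_(c : 'F_q) \sum_(l : 'I_q)
        (shift (c * psi)%R x \in D l))%N).
      apply: leq_sum => x _; case: ifP => // Tx.
      have [c [l [h1 h2]]] := tilt_drop pr_q psi0 (ltn0Sn _) Tx.
      by rewrite (bigD1 c) //= (bigD1 l) //= inE h1 h2.
    rewrite exchange_big /= -[X in (_ <= X * _)%N](card_Fp pr_q) -sum_nat_const leq_sum // => c _.
    rewrite exchange_big leq_sum //= => l _.
    rewrite -sum1_card [leqRHS]big_mkcond /= [leqRHS](reindex_inj (@shift_inj q N (c * psi))) /=.
    by apply: leq_sum => x _; case: (_ \in _).
  have q_gt0 := prime_gt0 pr_q.
  have : (16 * q ^ 2 * (\sum_l #|D l|) <= \sum_(l : 'I_q) (q ^ N - 1))%N.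
    rewrite big_distrr leq_sum //= => l _; have := small l; rewrite -ltnNge subn1; case: (q ^ N)%N => // Q.
  rewrite sum_nat_const card_ord; move: bound; set S := (\sum_l _)%N; set B := #|_|.
  have : (0 < q ^ N)%N by rewrite expn_gt0 q_gt0.
  move: (q ^ N)%N => Q Q_gt0 bound h1 h2.
  have h3 : (q * Q <= q * (16 * B))%N by rewrite leq_mul2l h2 orbT.
  have h4 : (q * (16 * B) <= 16 * q ^ 2 * S)%N.
    by rewrite mulnCA -mulnA leq_mul2l /= -mulnA leq_mul2l bound orbT.
  have h5 : (q * (Q - 1) < q * Q)%N by rewrite ltn_mul2l q_gt0; lia.
  lia.
exists (D l); split=> // x y; rewrite !inE => /andP[_ hx] /andP[hy _].
have := tilt_diff (shift psi x) y; rewrite ltnNge; apply: contraTN => le_h.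
rewrite -ltNge; apply: (@lt_le_trans _ _ L%:Z); first by rewrite /L; lia.
rewrite distrC; apply: le_trans (ler_norm _); rewrite lerBrDr.
by apply: le_trans hy; rewrite mulSn; lia.
Qed.

(** * Embedding F_q^d into the integers *)

Lemma sum_digits_lt (B n : nat) (y : nat -> int) :
  (forall i, `|y i| < B%:Z) -> `|\sum_(0 <= i < n) y i * B%:Z ^+ i| < B%:Z ^+ n.
Proof.
move=> lt_y; elim: n => [|n IHn]; first by rewrite big_geq // normr0 expr0.
rewrite big_nat_recr //= exprS; apply: le_lt_trans (ler_normD _ _) _.
have B_ge0 : 0 <= B%:Z ^+ n by rewrite exprn_ge0.
rewrite normrM (ger0_norm B_ge0).
have /(ler_wpM2r B_ge0) : `|y n| <= B%:Z - 1 by have := lt_y n; lia.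
rewrite mulrBl mul1r; move: IHn; set u := `|_|; set v := `|_| * _; set w := B%:Z ^+ n; lia.
Qed.

Lemma digit_split (B d : nat) (y : 'I_d -> int) (j : 'I_d) :
  (forall i, `|y i| < B%:Z) -> exists lo_hi : int * int,
    \sum_i y i * B%:Z ^+ i = lo_hi.1 + y j * B%:Z ^+ j + lo_hi.2 * B%:Z ^+ j.+1 /\
    `|lo_hi.1| < B%:Z ^+ j.
Proof.
move=> lt_y; pose Y i : int := if insub i is Some k then y k else 0.
have lt_Y i : `|Y i| < B%:Z.
  rewrite /Y; case: insubP => [k _ _|_]; first exact: lt_y.
  by rewrite normr0; apply: le_lt_trans (lt_y j).
have -> : \sum_i y i * B%:Z ^+ i = \sum_(0 <= i < d) Y i * B%:Z ^+ i.
  by rewrite big_mkord; apply: eq_bigr => i _; rewrite /Y valK.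
exists (\sum_(0 <= i < j) Y i * B%:Z ^+ i, \sum_(j.+1 <= i < d) Y i * B%:Z ^+ (i - j.+1)).
split; last exact: sum_digits_lt.
rewrite /= (big_cat_nat (n := j)) //=; last exact: ltnW.
rewrite -addrA; congr (_ + _); rewrite big_ltn // {1}/Y valK; congr (_ + _).
rewrite mulr_suml; apply: eq_big_nat => i /andP[ji _].
by rewrite -mulrA -exprD subnK.
Qed.

(* In a vanishing integer combination the lower digits contribute less than [L * B ^ j] at
   position [j], where [B = q * L], so the multiples of [L] must cancel modulo [q]. *)
Lemma digit_comb (I : finType) (q L d : nat) (c : I -> int) (y : I -> 'I_d -> int)
    (j : 'I_d) (m beta omega : int) :
  prime q -> (forall i l, `|y i l| < (q * L)%N%:Z) ->
  \sum_i c i * (\sum_l y i l * (q * L)%N%:Z ^+ l) + m * (q * L)%N%:Z ^+ d = 0 ->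
  \sum_i c i * y i j = beta * L%:Z + omega ->
  `|omega| + \sum_i `|c i| <= L%:Z -> 0 < \sum_i `|c i| ->
  beta%:~R = 0 :> 'F_q.
Proof.
move=> pr_q; set B := (q * L)%N => lt_y sum0 eq_j small c_gt0.
have /fin_all_exists[lh lhP] : forall i, exists lo_hi : int * int,
    \sum_l y i l * B%:Z ^+ l = lo_hi.1 + y i j * B%:Z ^+ j + lo_hi.2 * B%:Z ^+ j.+1 /\
    `|lo_hi.1| < B%:Z ^+ j by move=> i; apply: digit_split.
have q_gt0 := prime_gt0 pr_q.
have L_gt0 : 0 < L%:Z.
  by apply: lt_le_trans small; apply: ltr_wpDl.
have Bj_gt0 : 0 < B%:Z ^+ j by rewrite exprn_gt0 // ltz_nat muln_gt0 q_gt0 -ltz_nat.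
pose lo := \sum_i c i * (lh i).1; pose hi := \sum_i c i * (lh i).2.
have main : (beta * L%:Z + omega) * B%:Z ^+ j + lo +
    (hi + m * B%:Z ^+ (d - j.+1)) * B%:Z ^+ j.+1 = 0.
  rewrite -sum0 -eq_j mulrDl -mulrA -exprD subnK // addrA; congr (_ + _).
  rewrite /lo /hi !mulr_suml -!big_split /=; apply: eq_bigr => i _.
  by have [-> _] := lhP i; ring.
have lo_lt : `|lo| < \sum_i `|c i| * B%:Z ^+ j.
  rewrite /lo; apply: le_lt_trans (ler_norm_sum _ _ _) _.
  apply: (@le_lt_trans _ _ (\sum_i `|c i| * (B%:Z ^+ j - 1))).
    apply: ler_sum => i _; rewrite normrM ler_wpM2l //.
    by have [_] := lhP i; lia.
  by rewrite -!mulr_suml ltr_pM2l // ltrBlDr ltrDl.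
(* [rho] is smaller than [L * B ^ j] and, by the relation, a multiple of it; so it is 0, and [beta]
   is a multiple of [q]. *)
pose rho := omega * B%:Z ^+ j + lo.
have rho_lt : `|rho| < L%:Z * B%:Z ^+ j.
  apply: le_lt_trans (ler_normD _ _) _; rewrite normrM (gtr0_norm Bj_gt0).
  apply: lt_le_trans (_ : (`|omega| + \sum_i `|c i|) * B%:Z ^+ j <= _).
    by rewrite mulrDl ltrD2l mulr_suml.
  by rewrite ler_pM2r.
have Bexp : B%:Z ^+ j.+1 = q%:Z * (L%:Z * B%:Z ^+ j) by rewrite exprS {1}/B PoszM mulrA.
set h := hi + _ in main; pose G := L%:Z * B%:Z ^+ j.
have G_gt0 : 0 < G by rewrite mulr_gt0.
have main2 : rho = - (beta + h * q%:Z) * G.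
  have := main; rewrite Bexp -/G /rho => E.
  have -> : omega * B%:Z ^+ j + lo = 0 - (beta * G + h * (q%:Z * G)) by rewrite -E /G; ring.
  by ring.
have zero : beta + h * q%:Z = 0.
  move: rho_lt; rewrite main2 normrM normrN (gtr0_norm G_gt0) -/G.
  by rewrite -[ltRHS]mul1r ltr_pM2r //; lia.
have -> : beta = - (h * q%:Z) by lia.
by rewrite rmorphN rmorphM /= -pmulrn pchar_Fp_0 // mulr0 oppr0.
Qed.

Definition emb (q L d : nat) (x : {ffun 'I_d -> 'F_q}) : int :=
  \sum_j ((x j * L)%N%:Z * (q * L)%N%:Z ^+ j).

Definition mismatch (q d k : nat) (u v : 'I_k -> {ffun 'I_d -> 'F_q}) : {set 'I_d} :=
  \bigcup_i [set j | shift 1 (v i) j != u i j].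

Lemma card_mismatch (q d k r : nat) (u v : 'I_k -> {ffun 'I_d -> 'F_q}) :
  (forall i, (hamming (shift 1%R (v i)) (u i) <= r)%N) -> (#|mismatch u v| <= k * r)%N.
Proof.
move=> le_r; apply: (@leq_trans (\sum_(i < k) r)%N); last by rewrite sum_nat_const card_ord.
rewrite /mismatch; elim/big_rec2: _ => [|i n A _ IH]; first by rewrite cards0.
by rewrite (leq_trans (leq_card_setU _ _)) // leq_add // le_r.
Qed.

Lemma ltn_Fp (q : nat) (a : 'F_q) : prime q -> (a < q)%N.
Proof. by move=> pr_q; rewrite -[X in (_ < X)%N](Fp_cast pr_q) ltn_ord. Qed.

Lemma intr_Fp (q : nat) (a : 'F_q) : ((a : nat)%:Z)%:~R = a.
Proof. by rewrite -pmulrn natr_Zp. Qed.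

(** Outside the mismatches [u i - v i] is 1 modulo [q], so the leading parts of the digits at [j]
    only see the sum of the coefficients. The margin between the low parts and [L] absorbs the
    contribution of the lower digits. *)
Lemma relation_shift (q L d k : nat) (c : 'I_k -> int) (P : pred 'I_k)
    (u v : 'I_k -> {ffun 'I_d -> 'F_q}) (b b' w w' : 'I_d -> nat) (m : int) (j : 'I_d) :
  prime q ->
  (forall l, b l < q)%N -> (forall l, b' l < q)%N ->
  (forall l, w l + \sum_i `|c i| < L)%N -> (forall l, w' l + \sum_i `|c i| < L)%N ->
  \sum_l ((b l * L + w l)%N%:Z - (b' l * L + w' l)%N%:Z) * (q * L)%N%:Z ^+ l +
    m * (q * L)%N%:Z ^+ d +
    \sum_(i | P i) c i * (emb L (u i) - emb L (v i)) = 0 ->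
  j \notin mismatch u v ->
  (b j)%:R + (\sum_(i | P i) c i)%:~R = (b' j)%:R :> 'F_q.
Proof.
move=> pr_q lt_b lt_b' lt_w lt_w' sum0 good_j.
have q_gt0 := prime_gt0 pr_q.
(* [None] stands for the difference of the two numbers with digits [b L + w] and [b' L + w'], with
   coefficient 1. *)
pose c' (o : option 'I_k) : int := if o is Some i then (if P i then c i else 0) else 1.
pose y (o : option 'I_k) (l : 'I_d) : int :=
  if o is Some i then (u i l * L)%N%:Z - (v i l * L)%N%:Z
  else (b l * L + w l)%N%:Z - (b' l * L + w' l)%N%:Z.
have digit n z : (n < q)%N -> (z < L)%N -> (n * L + z < q * L)%N.
  move=> lt_n lt_z; apply: (@leq_trans (n.+1 * L)%N); last by rewrite leq_mul2r lt_n orbT.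
  by rewrite mulSn addnC ltn_add2r.
have [M eqM] : exists M, M = (\sum_i `|c i|)%N by exists (\sum_i `|c i|)%N.
rewrite -eqM in lt_w lt_w'.
have L_gt0 : (0 < L)%N by have := lt_w j; lia.
have big_opt (F : option 'I_k -> int) : \sum_o F o = F None + \sum_i F (Some i).
  rewrite (bigD1 None) //=; congr (_ + _).
  rewrite (reindex_omap Some id) /=; last by case.
  by apply: eq_bigl => i; rewrite eqxx.
pose beta := (b j)%:Z - (b' j)%:Z + \sum_(i | P i) c i * ((u i j)%:Z - (v i j)%:Z).
have : beta%:~R = 0 :> 'F_q.
  apply: (@digit_comb _ q L d c' y j m beta ((w j)%:Z - (w' j)%:Z)) => //.
  - case=> [i|] l /=.
      have := digit (u i l) 0%N (ltn_Fp _ pr_q) L_gt0.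
      have := digit (v i l) 0%N (ltn_Fp _ pr_q) L_gt0.
      by rewrite !addn0; lia.
    have := digit _ (w l) (lt_b l); have := digit _ (w' l) (lt_b' l).
    by have := lt_w l; have := lt_w' l; lia.
  - rewrite -[RHS]sum0 big_opt /= mul1r addrAC; congr (_ + _ + _).
    rewrite [RHS]big_mkcond; apply: eq_bigr => i _; case: ifP => _; rewrite ?mul0r //.
    by congr (_ * _); rewrite /emb -sumrB; apply: eq_bigr => l _; rewrite mulrBl.
  - rewrite big_opt /= mul1r /beta mulrDl mulr_suml.
    rewrite [\sum_(i | P i) _]big_mkcond /=.
    have -> : \sum_i (if P i then c i else 0) * ((u i j * L)%N%:Z - (v i j * L)%N%:Z) =
        \sum_i (if P i then c i * ((u i j)%:Z - (v i j)%:Z) * L%:Z else 0).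
      by apply: eq_bigr => i _; case: ifP => _; rewrite ?mul0r // !PoszM; ring.
    by rewrite !PoszD !PoszM; ring.
  - have : `|(w j)%:Z - (w' j)%:Z| + 1 + M%:Z <= L%:Z.
      by have := lt_w j; have := lt_w' j; lia.
    rewrite -addrA; apply: le_trans; rewrite lerD2l big_opt /= normr1 lerD2l eqM.
    rewrite -natz natr_sum; apply: ler_sum => i _.
    by rewrite natz -abszE; case: ifP; rewrite ?normr0.
  - by rewrite big_opt /= normr1; apply: ltr_wpDr => //; apply: sumr_ge0.
rewrite /beta rmorphD rmorphB /= -!pmulrn !rmorph_sum /=.
have -> : \sum_(i | P i) (c i * ((u i j)%:Z - (v i j)%:Z))%:~R = \sum_(i | P i) (c i)%:~R :> 'F_q.
  apply: eq_bigr => i _; rewrite rmorphM rmorphB /= !intr_Fp.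
  have : shift 1 (v i) j == u i j.
    by apply: contraNT good_j => ne; apply/bigcupP; exists i => //; rewrite inE.
  by move/eqP <-; rewrite ffunE addrAC subrr add0r mulr1.
by move/eqP; rewrite addrAC subr_eq0 => /eqP.
Qed.

(** An equality would be a relation with the single coefficient 1, and would yield 1 = 0 modulo [q]
    at a coordinate without mismatch. *)
Lemma emb_inj_step (q L d r : nat) (x y : {ffun 'I_d -> 'F_q}) :
  prime q -> (1 < L)%N -> (r < d)%N -> (hamming (shift 1%R y) x <= r)%N ->
  emb L x != emb L y.
Proof.
move=> pr_q L_gt1 lt_rd le_r; apply/eqP => eq_xy.
have := @card_mismatch q d 1 r (fun=> x) (fun=> y) (fun=> le_r); rewrite mul1n => le_mm.
have [j good_j] : exists j, j \notin mismatch (k := 1) (fun=> x) (fun=> y).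
  apply/existsP; rewrite -negb_forall; apply: contraTN lt_rd => /forallP full.
  rewrite -leqNgt; apply: leq_trans le_mm; rewrite (eq_card (B := predT)) ?cardT ?size_enum_ord //.
have pos : (0 < q)%N := prime_gt0 pr_q.
have small : forall l : 'I_d, (0 + \sum_(i < 1) `|1 : int| < L)%N by move=> _; rewrite big_ord1.
have := @relation_shift q L d 1 (fun=> 1) xpredT (fun=> x) (fun=> y)
  (fun=> 0%N) (fun=> 0%N) (fun=> 0%N) (fun=> 0%N) 0 j pr_q
  (fun=> pos) (fun=> pos) small small.
rewrite !big_ord1 eq_xy !subrr mulr0 mul0r !addr0.
rewrite big1 => [/(_ erefl good_j) /eqP|i _]; last by rewrite mul0r.
by rewrite add0r oner_eq0.
Qed.

Lemma sum_ord_digits_lt (B d : nat) (y : 'I_d -> int) :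
  (0 < B)%N -> (forall i, `|y i| < B%:Z) -> `|\sum_i y i * B%:Z ^+ i| < B%:Z ^+ d.
Proof.
move=> B_gt0 lt_y; pose Y i : int := if insub i is Some k then y k else 0.
have lt_Y i : `|Y i| < B%:Z.
  by rewrite /Y; case: insubP => [k _ _|_]; rewrite ?lt_y // normr0.
have := sum_digits_lt d lt_Y; rewrite big_mkord.
by under eq_bigr => i _ do rewrite /Y valK.
Qed.

Lemma emb_bound (q L d : nat) (x y : {ffun 'I_d -> 'F_q}) :
  prime q -> (0 < L)%N -> `|emb L x - emb L y| < (q * L)%N%:Z ^+ d.
Proof.
move=> pr_q L_gt0; rewrite /emb -sumrB.
under eq_bigr => j _ do rewrite -mulrBl.
apply: sum_ord_digits_lt; first by rewrite muln_gt0 prime_gt0.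
move=> j; have := ltn_mul2r L (x j) q; have := ltn_mul2r L (y j) q.
by rewrite L_gt0 !ltn_Fp //=; lia.
Qed.

(** * Digits, cancelling coefficients and estimates for the assembly *)

Lemma expansion_inj (B d m m' : nat) (y y' : nat -> nat) :
  (forall i, y i < B)%N -> (forall i, y' i < B)%N ->
  (\sum_(0 <= i < d) y i * B ^ i + m * B ^ d = \sum_(0 <= i < d) y' i * B ^ i + m' * B ^ d)%N ->
  (forall i, (i < d)%N -> y i = y' i) /\ m = m'.
Proof.
move=> lt_y lt_y'; elim: d m m' => [|d IHd] m m'.
  by rewrite !big_geq // !expn0 !muln1 !add0n.
rewrite !big_nat_recr //= !expnS !(mulnA m) !(mulnA m') -!addnA -!mulnDl.
case/IHd => eq_y eq_m.
have B_gt0 : (0 < B)%N by apply: leq_ltn_trans (lt_y 0%N).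
have eq_d : y d = y' d.
  by have := congr1 (modn^~ B) eq_m; rewrite /= !(addnC (y _)) !(addnC (y' _)) !modnMDl !modn_small.
split=> [i|]; last first.
  by apply/eqP; rewrite -(eqn_pmul2r B_gt0); apply/eqP; move: eq_m; rewrite eq_d; apply: addnI.
by rewrite ltnS leq_eqVlt => /orP[/eqP->|/eq_y].
Qed.

(** Two disjoint cancelling pairs would be four coefficients of sum 0, so any two cancelling pairs
    share an index and hence an absolute value. If there is none, [a = 1] will do. *)
Lemma pair_coef (k : nat) (c : 'I_k -> int) :
  (0 < k)%N -> (forall i, c i != 0) ->
  (forall I : {set 'I_k}, (3 <= #|I|)%N -> \sum_(i in I) c i != 0) ->
  exists a : nat, [/\ (0 < a)%N, (a <= \sum_i `|c i|)%N &
    forall i j, i != j -> c i + c j = 0 -> `|c i|%N = a].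
Proof.
move=> k_gt0 c_neq0 no_sum.
have c_le i : (`|c i| <= \sum_i `|c i|)%N by rewrite (bigD1 i) //= leq_addr.
have c_gt0 i : (0 < `|c i|)%N by rewrite absz_gt0.
case: (boolP [exists i, exists j, (i != j) && (c i + c j == 0)]) => [|no]; last first.
  exists 1%N; split=> //; first exact: leq_trans (c_gt0 (Ordinal k_gt0)) (c_le _).
  move=> i j ij cij; case/existsP: no; exists i; apply/existsP; exists j.
  by rewrite ij cij eqxx.
case/existsP => i0 /existsP[j0 /andP[ij0 /eqP cij0]].
exists `|c i0|%N; split=> // i j ij cij.
have [|disj] := boolP [|| i == i0, i == j0, j == i0 | j == j0].
  by case/or4P => /eqP E; move: cij cij0; rewrite E; lia.
move: disj; rewrite !negb_or => /and4P[n1 n2 n3 n4].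
have := no_sum (i |: (j |: (i0 |: [set j0]))).
rewrite !big_setU1 ?big_set1 ?inE ?negb_or ?n1 ?n2 ?n3 ?n4 ?ij ?ij0 //=.
rewrite !cardsU1 cards1 !inE ?negb_or n1 n2 n3 n4 ij ij0 => /(_ isT) /eqP[].
by lia.
Qed.

Lemma eq0_Fp_small (p : nat) (z : int) :
  prime p -> z%:~R = 0 :> 'F_p -> `|z| < p%:Z -> z = 0.
Proof.
move=> pr_p z0 lt_z; apply/eqP; rewrite -absz_eq0.
have : (`|z|%N%:R : 'F_p) == 0.
  by case: (intP z) z0 {lt_z} => // n; rewrite ?mulrNz ?abszN -?pmulrn => /eqP; rewrite ?oppr_eq0.
rewrite -(dvdn_pcharf (pchar_Fp pr_p)) => /dvdnP[m def_z].
case: m def_z => [->//|m def_z]; move: lt_z; rewrite -abszE def_z mulSn; lia.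
Qed.

(** Bernoulli's inequality [(1 - 1 / (2 d)) ^ d >= 1 / 2]: removing [M] of the [L = 2 d M] low parts
    in every digit costs at most a factor 2. *)
Lemma bernoulli_half (M d : nat) : (0 < d)%N ->
  ((2 * d * M) ^ d <= 2 * (2 * d * M - M) ^ d)%N.
Proof.
move=> d_gt0; rewrite -[X in (_ - X)%N]mul1n -mulnBl !expnMn mulnA leq_mul2r; apply/orP; right.
have [n def_n] : exists n, (2 * d = n.+1)%N by exists (2 * d).-1; lia.
rewrite -expnMn def_n subn1 /=.
have step k : (n.+1 * n.+1 ^ k <= n.+1 * n ^ k + k * n.+1 ^ k)%N.
  elim: k => [|k IHk]; first by rewrite !expn0 leq_addr.
  have le_k : (n ^ k <= n.+1 ^ k)%N by case: k {IHk} => // k; rewrite leq_exp2r.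
  rewrite !expnS; move: IHk le_k; move: (n ^ k)%N (n.+1 ^ k)%N => u v; nia.
have := step d; move: (n.+1 ^ d)%N (n ^ d)%N => u v; nia.
Qed.

Lemma PoszX (m n : nat) : (m ^ n)%N%:Z = m%:Z ^+ n.
Proof. by rewrite -!natz natrX. Qed.

Lemma Posz_expansion (B d : nat) (y : 'I_d -> nat) :
  (\sum_(j < d) y j * B ^ j)%N%:Z = \sum_(j < d) (y j)%:Z * B%:Z ^+ j.
Proof. by rewrite -natz natr_sum; apply: eq_bigr => j _; rewrite natz PoszM PoszX. Qed.

(** * Construction of the set and its three properties *)

Theorem theorem5p1 (k : nat) (c : 'I_k -> int) :
  (3 <= k)%N ->
  (forall i, c i != 0) ->
  (forall I : {set 'I_k}, (3 <= #|I|)%N -> \sum_(i in I) c i != 0) ->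
  exists eps : rat, 0 < eps /\
    forall t : nat, exists P0 : nat, forall p : nat, prime p -> (P0 <= p)%N ->
      exists A : {set 'F_p},
        [/\ solution_free c A, eps * p%:R <= #|A|%:R & chi_ge A t].
Proof.
move=> k_ge3 c_neq0 no_sum.
have k_gt0 : (0 < k)%N by apply: leq_trans k_ge3.
have [a [a_gt0 a_le aP]] := pair_coef k_gt0 c_neq0 no_sum.
pose C := \sum_i c i; pose M := (\sum_i `|c i|)%N.
have C_neq0 : C != 0.
  have := no_sum setT; rewrite cardsT card_ord => /(_ k_ge3).
  by rewrite (eq_bigl xpredT) // => i; rewrite inE.
have M_gt0 : (0 < M)%N by apply: leq_trans a_gt0 a_le.
have [q lt_Cq pr_q] := prime_above `|C|.
have q_gt0 := prime_gt0 pr_q.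
have Cq_neq0 : C%:~R != 0 :> 'F_q.
  apply: contra C_neq0 => /eqP C0; apply/eqP/(eq0_Fp_small pr_q C0).
  by rewrite -abszE ltz_nat.
(* A solution with two entries in the dense set will say that one point of [D0] is nearly the other
   one shifted by [- C]. *)
pose psi : 'F_q := - C%:~R.
have psi_neq0 : psi != 0 by rewrite oppr_eq0.
(* The product of the losses: [10 M ^ 2] for the length of the interval, 2 for rounding it to
   multiples of [B ^ d], [16 q ^ 2] for [D0], and 2 for the low parts. *)
exists ((640 * q ^ 2 * M ^ 2)%N%:R^-1); split.
  by rewrite invr_gt0 ltr0n !muln_gt0 ?expn_gt0 q_gt0 M_gt0.
(* [r] is the error in [shifted_coloring] for at most [t] colours, and [K] bounds the coordinates
   spoilt by [k] such pairs. *)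
move=> t; pose r := (t * q)%N; pose K := (k * r)%N.
have [N0 denseN0] := dense_shift_avoiding K pr_q psi_neq0.
(* As [d] exceeds [K], some coordinate escapes all mismatches. Low parts below [L'] keep the margin
   [M] required by [relation_shift]. *)
pose d := maxn N0 K.+1; pose L := (2 * d * M)%N; pose L' := (L - M)%N; pose B := (q * L)%N.
have [D0 [card_D0 avoid]] := denseN0 d (leq_maxl _ _).
have lt_Kd : (K < d)%N by rewrite leq_maxr.
have d_gt0 : (0 < d)%N by apply: leq_ltn_trans lt_Kd.
have lt_ML : (M < L)%N by rewrite /L; nia.
have L_gt0 : (0 < L)%N by apply: leq_ltn_trans lt_ML.
have B_gt0 : (0 < B)%N by rewrite muln_gt0 q_gt0.
have lt_rd : (r < d)%N by apply: leq_ltn_trans lt_Kd; rewrite /K leq_pmull.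
exists (5 * M ^ 2 * (M * B ^ d))%N => p pr_p le_p.
have p_gt0 := prime_gt0 pr_p.
(* The dense part lies in [[X, X + Dl)] and the sparse part in [[-Dl, Dl]]. Since [M (X + Dl) < p],
   a solution holds over the integers; since [M Dl < X], its coefficients on the dense part sum to
   0. *)
pose Dl := (p %/ (5 * M ^ 2))%N; pose X := (2 * M * Dl)%N; pose mm := (Dl %/ B ^ d)%N.
have M2_gt0 : (0 < 5 * M ^ 2)%N by rewrite muln_gt0 expn_gt0 M_gt0.
have Bd_gt0 : (0 < B ^ d)%N by rewrite expn_gt0 B_gt0.
have le_Dl : (M * B ^ d <= Dl)%N by rewrite leq_divRL // mulnC.
have Dl_gt0 : (0 < Dl)%N by apply: leq_trans le_Dl; rewrite muln_gt0 M_gt0.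
have mm_gt0 : (0 < mm)%N.
  rewrite divn_gt0 //; apply: leq_trans le_Dl; exact: leq_pmull.
have Dl_p : (5 * M ^ 2 * Dl <= p)%N by rewrite mulnC leq_trunc_div.
(* The low parts [x.2.2] and the top digit [x.1] are free; they let these numbers fill a constant
   proportion of the interval. *)
pose delta (x : 'I_mm * ({ffun 'I_d -> 'F_q} * {ffun 'I_d -> 'I_L'})) : nat :=
  (\sum_(j < d) (x.2.1 j * L + x.2.2 j) * B ^ j + x.1 * B ^ d)%N.
have lt_w (w : 'I_L') : (w + M < L)%N by rewrite addnC -ltn_subRL ltn_ord.
have digit_lt (b : 'F_q) (w : 'I_L') : (b * L + w < B)%N.
  apply: (@leq_trans (b.+1 * L)%N); last by rewrite leq_mul2r ltn_Fp ?orbT.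
  by rewrite mulSn addnC ltn_add2r; apply: leq_trans (lt_w w); rewrite ltnS leq_addr.
have delta_lt x : (delta x < Dl)%N.
  apply: (@leq_trans (mm * B ^ d)%N); last exact: leq_trunc_div.
  apply: (@leq_trans (x.1.+1 * B ^ d)%N); last by rewrite leq_mul2r ltn_ord orbT.
  rewrite mulSn ltn_add2r -ltz_nat PoszX Posz_expansion.
  have := @sum_ord_digits_lt B d (fun j => (x.2.1 j * L + x.2.2 j)%N%:Z) B_gt0.
  rewrite ger0_norm; last by apply: sumr_ge0 => j _; rewrite mulr_ge0 ?exprn_ge0.
  by apply=> j; rewrite ger0_norm // ltz_nat digit_lt.
have lt_Xp x : (X + delta x < p)%N.
  apply: leq_trans Dl_p; apply: (@leq_trans (X + Dl)%N); first by rewrite ltn_add2l.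
  have aux M' D' : (0 < M' -> 2 * M' * D' + D' <= 5 * M' ^ 2 * D')%N by clear; nia.
  exact: aux.
have delta_inj : injective delta.
  move=> [m [b w]] [m' [b' w']]; rewrite /delta /=.
  pose Y (b0 : {ffun 'I_d -> 'F_q}) (w0 : {ffun 'I_d -> 'I_L'}) (i : nat) : nat :=
    if insub i is Some j then (b0 j * L + w0 j)%N else 0%N.
  have Y_lt b0 w0 i : (Y b0 w0 i < B)%N.
    by rewrite /Y; case: insubP => [j _ _|_] //; apply: digit_lt.
  have YE (b0 : {ffun 'I_d -> 'F_q}) (w0 : {ffun 'I_d -> 'I_L'}) :
      (\sum_(j < d) (b0 j * L + w0 j) * B ^ j = \sum_(0 <= i < d) Y b0 w0 i * B ^ i)%N.
    by rewrite big_mkord; apply: eq_bigr => j _; rewrite /Y valK.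
  rewrite !YE => /(expansion_inj (Y_lt b w) (Y_lt b' w'))[eqY /val_inj ->].
  have small_w (w0 : 'I_L') : (w0 < L)%N by apply: leq_trans (lt_w w0); rewrite ltnS leq_addr.
  have eq_j j : b j = b' j /\ w j = w' j.
    have := eqY j (ltn_ord j); rewrite /Y !valK => E; split; apply: val_inj.
      have := congr1 (divn^~ L) E; rewrite /= !divnMDl // !divn_small // !addn0.
      by [].
    by have := congr1 (modn^~ L) E; rewrite /= !modnMDl !modn_small.
  by congr (_, (_, _)); apply/ffunP => j; case: (eq_j j).
pose Dset : {set 'F_p} := [set (X + delta x)%N%:R | x in setX setT (setX D0 setT)].
(* The factor [a] is the absolute value of any two cancelling coefficients, so it can be divided out
   of the equation below. *)
pose Sset : {set 'F_p} := [set (a%:Z * (emb L uv.1 - emb L uv.2))%:~R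
   | uv : {ffun 'I_d -> 'F_q} * {ffun 'I_d -> 'F_q} &
     (hamming (shift 1%R uv.2) uv.1 <= r)%N].
have S_small (u v : {ffun 'I_d -> 'F_q}) : `|a%:Z * (emb L u - emb L v)| <= Dl%:Z.
  rewrite normrM ger0_norm //; apply: le_trans (_ : M%:Z * (B ^ d)%N%:Z <= _); last first.
    by rewrite -PoszM lez_nat.
  apply: ler_pM => //.
  by rewrite PoszX ltW // emb_bound.
exists (Sset :|: Dset); split.
- case=> x [_ xA sum_x].
  have /fin_all_exists[g gP] i : exists g : ({ffun 'I_d -> 'F_q} * {ffun 'I_d -> 'F_q}) *
      option ('I_mm * ({ffun 'I_d -> 'F_q} * {ffun 'I_d -> 'I_L'})),
      (hamming (shift 1%R g.1.2) g.1.1 <= r)%N /\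
      if g.2 is Some e then e.2.1 \in D0 /\ x i = (X + delta e)%N%:R
      else x i = (a%:Z * (emb L g.1.1 - emb L g.1.2))%:~R.
    have := xA i; rewrite inE => /orP[] /imsetP.
      by case=> uv; rewrite inE => le_uv ->; exists (uv, None).
    case=> e; rewrite !inE /= andbT => De ->.
    (* A dense entry receives a dummy pair without mismatch, so that [u] and [v] are defined for all
       indices. *)
    exists ((shift 1%R [ffun=> 0%R], [ffun=> 0%R]), Some e); split=> //=.
    by rewrite /hamming eq_card0 // => j; rewrite !inE eqxx.
  pose u i := (g i).1.1; pose v i := (g i).1.2.
  pose I := [set i | isSome (g i).2].
  pose err i : int := if (g i).2 is Some e then (delta e)%:Z
                      else a%:Z * (emb L (u i) - emb L (v i)).
  have err_le i : `|err i| <= Dl%:Z.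
    rewrite /err; case: (g i).2 => [e|]; last exact: S_small.
    by rewrite (ger0_norm (le0z_nat _)) lez_nat; exact: ltnW (delta_lt e).
  pose Err := \sum_i c i * err i.
  have Err_le : `|Err| <= (M * Dl)%N%:Z.
    apply: le_trans (ler_norm_sum _ _ _) _; rewrite PoszM /M -[X in X * _]natz natr_sum mulr_suml.
    by apply: ler_sum => i _; rewrite normrM natz abszE ler_wpM2l.
  have cI_le : `|\sum_(i in I) c i| <= M%:Z.
    apply: le_trans (ler_norm_sum _ _ _) _; rewrite big_mkcond /M -[leRHS]natz natr_sum.
    by apply: ler_sum => i _; rewrite natz abszE; case: ifP.
  have total : (\sum_(i in I) c i) * X%:Z + Err = 0.
    apply: (eq0_Fp_small pr_p); last first.
      apply: le_lt_trans (ler_normD _ _) _; rewrite normrM (ger0_norm (le0z_nat _)).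
      apply: (@le_lt_trans _ _ (M%:Z * X%:Z + (M * Dl)%N%:Z)).
        by rewrite lerD // ler_wpM2r.
      rewrite -PoszM -PoszD ltz_nat; apply: leq_trans Dl_p.
      have aux M' D' : (0 < M' -> 0 < D' -> M' * (2 * M' * D') + M' * D' < 5 * M' ^ 2 * D')%N.
        by clear; nia.
      exact: aux.
    rewrite -[RHS]sum_x mulr_suml big_mkcond -big_split /= rmorph_sum; apply: eq_bigr => i _.
    have [_] := gP i; rewrite !inE /err; case: (g i).2 => [e [_ ->]|->] /=.
      by rewrite -mulrDr rmorphM /= -PoszD -pmulrn.
    by rewrite add0r rmorphM.
  have cI0 : \sum_(i in I) c i = 0.
    apply/eqP; apply: contraT => cI_neq0; have := Err_le.
    have -> : Err = - ((\sum_(i in I) c i) * X%:Z).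
      by apply/eqP; rewrite -addr_eq0 addrC total.
    rewrite normrN normrM (ger0_norm (le0z_nat _)) => le_X.
    have ge1 : 1 <= `|\sum_(i in I) c i| by rewrite -gtz0_ge1 normr_gt0.
    have := le_trans (ler_peMl (le0z_nat X) ge1) le_X.
    by rewrite lez_nat /X -mulnA leqNgt mul2n -addnn
      -[X in (X < _)%N]addn0 ltn_add2l muln_gt0 M_gt0 Dl_gt0.
  have card_mm : (#|mismatch u v| <= K)%N.
    by apply: card_mismatch => i; have [] := gP i.
  have [j good_j] : exists j, j \notin mismatch u v.
    apply/existsP; rewrite -negb_forall; apply: contraTN lt_Kd => /forallP full.
    rewrite -leqNgt; apply: leq_trans card_mm.
    by rewrite (eq_card (B := predT)) ?cardT ?size_enum_ord.
  have sumC : \sum_(i | i \notin I) c i = C.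
    by rewrite /C [RHS](bigID (mem I)) /= cI0 add0r.
  have ErrE : Err = \sum_(i in I) c i * err i +
      a%:Z * \sum_(i | i \notin I) c i * (emb L (u i) - emb L (v i)).
    rewrite /Err (bigID (mem I)) /= mulr_sumr; congr (_ + _); apply: eq_bigr => i.
    by rewrite inE /err; case: (g i).2 => // _; rewrite mulrCA.
  rewrite cI0 mul0r add0r ErrE in total.
  have : (#|I| < 3)%N by rewrite ltnNge; apply/negP => /no_sum; rewrite cI0 eqxx.
  have small_M (w : 'I_L') : (w + \sum_i `|c i| < L)%N by apply: lt_w.
  case card_I : #|I| => [|[|[|//]]] _.
  (* All entries are sparse: the relation, with dense digits 0, gives [C = 0] modulo [q]. *)
  + have I0 : I = set0 by apply: cards0_eq.
    move: total; rewrite I0 big_set0 add0r => /eqP; rewrite mulf_eq0 eqz_nat gtn_eqF //= => /eqP.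
    rewrite -I0 => total.
    have small0 : forall l : 'I_d, (0 + \sum_i `|c i| < L)%N by [].
    have := @relation_shift q L d k c (fun i => i \notin I) u v (fun=> 0%N) (fun=> 0%N)
      (fun=> 0%N) (fun=> 0%N) 0 j pr_q (fun=> q_gt0) (fun=> q_gt0) small0 small0.
    rewrite total mul0r !addr0 big1 => [/(_ erefl good_j)/eqP|l _]; last by rewrite ?subrr ?mul0r.
    by rewrite sumC add0r (negPf Cq_neq0).
  + have /cards1P[i0 I1] := introT eqP card_I.
    by have := c_neq0 i0; rewrite -cI0 I1 big_set1 eqxx.
  + have {card_I}/cards2P[i1 [i2 [ne_i I2]]] := introT eqP card_I.
    (* The two dense indices are ordered so that the first one carries [+ a]. *)
    have {i1 i2 ne_i I2}[i1 [i2 [ne_i I2 c1 c2]]] : exists i1 i2,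
        [/\ i1 != i2, I = [set i1; i2], c i1 = a%:Z & c i2 = - a%:Z].
      have c12 : c i1 + c i2 = 0 by rewrite -cI0 I2 big_setU1 ?inE // big_set1.
      have c1a := aP _ _ ne_i c12.
      have [c1 | c1] : c i1 = a%:Z \/ c i1 = - a%:Z by lia.
        by exists i1, i2; split=> //; lia.
      by exists i2, i1; split; rewrite 1?eq_sym // 1?setUC //; lia.
    have [e1 De1 err1] : exists2 e, e.2.1 \in D0 & err i1 = (delta e)%:Z.
      have : i1 \in I by rewrite I2 !inE eqxx.
      rewrite inE /err; have [_] := gP i1.
      by case: (g i1).2 => [e [De _]|//] _; exists e.
    have [e2 De2 err2] : exists2 e, e.2.1 \in D0 & err i2 = (delta e)%:Z.
      have : i2 \in I by rewrite I2 !inE eqxx orbT.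
      rewrite inE /err; have [_] := gP i2.
      by case: (g i2).2 => [e [De _]|//] _; exists e.
    have total' : (delta e1)%:Z - (delta e2)%:Z +
        \sum_(i | i \notin I) c i * (emb L (u i) - emb L (v i)) = 0.
      move: total; rewrite {1}I2 big_setU1 ?inE // big_set1 c1 c2 err1 err2.
      set S := \sum_(i | _) _ => total.
      have /eqP : a%:Z * ((delta e1)%:Z - (delta e2)%:Z + S) = 0 by rewrite -[RHS]total /=; ring.
      by rewrite mulf_eq0 eqz_nat gtn_eqF //= => /eqP.
    (* At every coordinate without mismatch the relation reads [e1 + C = e2] on leading parts, so
       the two points differ from a shift by [psi] in at most [K] places. *)
    suff far : (hamming (shift psi e2.2.1) e1.2.1 <= K)%N.
      by have := avoid _ _ De2 De1; rewrite ltnNge far.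
    apply: leq_trans card_mm; apply/subset_leq_card/subsetP => l; rewrite inE.
    apply: contraR => good_l.
    have rel := @relation_shift q L d k c (fun i => i \notin I) u v
      (fun l => e1.2.1 l) (fun l => e2.2.1 l) (fun l => e1.2.2 l) (fun l => e2.2.2 l)
      ((e1.1 : nat)%:Z - (e2.1 : nat)%:Z) l pr_q
      (fun l => ltn_Fp _ pr_q) (fun l => ltn_Fp _ pr_q) (fun l => small_M _) (fun l => small_M _).
    have {}rel := rel _ good_l; rewrite !natr_Zp sumC in rel.
    rewrite ffunE /psi -rel ?addrK // -[RHS]total'; congr (_ + _).
    rewrite /delta !PoszD !(PoszM _ (B ^ d)%N) PoszX !Posz_expansion -/B.
    rewrite (eq_bigr _ (fun i _ => mulrBl _ _ _)) sumrB; ring.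
- have card_D : #|Dset| = (mm * (#|D0| * L' ^ d))%N.
    rewrite card_imset; first by rewrite !cardsX !cardsT card_ord card_ffun !card_ord.
    move=> x y /(congr1 val) /=; rewrite !val_Fp_nat // !modn_small //.
    by move/addnI/delta_inj.
  rewrite ler_pdivrMl; last by rewrite ltr0n !muln_gt0 ?expn_gt0 q_gt0 M_gt0.
  rewrite -natrM ler_nat.
  apply: (@leq_trans (640 * q ^ 2 * M ^ 2 * #|Dset|)%N); last first.
    by rewrite leq_mul2l subset_leq_card ?orbT // subsetUr.
  have h1 : (p <= 10 * M ^ 2 * Dl)%N.
    have := ltn_ceil p M2_gt0; rewrite -/Dl; move: (M ^ 2)%N => M2; nia.
  have h2 : (Dl <= 2 * mm * B ^ d)%N.
    have := ltn_ceil Dl Bd_gt0; rewrite -/mm; nia.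
  have h3 : (B ^ d <= 32 * q ^ 2 * (#|D0| * L' ^ d))%N.
    rewrite /B expnMn; have := bernoulli_half M d_gt0; rewrite -/L -/L' => h.
    apply: leq_trans (leq_mul card_D0 h) _.
    by apply: eq_leq; move: (q ^ 2)%N (L' ^ d)%N => u v; ring.
  rewrite card_D.
  apply: leq_trans h1 _; apply: (@leq_trans (10 * M ^ 2 * (2 * mm * B ^ d)))%N.
    by rewrite leq_mul2l h2 orbT.
  apply: (@leq_trans (10 * M ^ 2 * (2 * mm * (32 * q ^ 2 * (#|D0| * L' ^ d)))))%N.
    by rewrite !leq_mul2l h3 !orbT.
  by apply/eq_leq; ring.
- move=> n lt_n [f proper].
  (* The colouring is pulled back to [F_q^d]; the monochromatic pair found there has its embedded
     difference in [Sset], hence is joined by an arc. *)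
  have [x [y [eq_xy le_h]]] := @shifted_coloring q d n (fun x => f (a%:Z * emb L x)%:~R) pr_q.
  have le_r : (hamming (shift 1%R x) y <= r)%N.
    by apply: leq_trans le_h _; rewrite leq_mul2r ltnW ?orbT.
  have ne_uv : (a%:Z * emb L x)%:~R != (a%:Z * emb L y)%:~R :> 'F_p.
    rewrite eq_sym -subr_eq0 -rmorphB -mulrBr; apply/eqP => /(eq0_Fp_small pr_p) z0.
    have /eqP : a%:Z * (emb L y - emb L x) = 0.
      by apply: z0; apply: le_lt_trans (S_small _ _) _; rewrite ltz_nat; nia.
    rewrite mulf_eq0 eqz_nat gtn_eqF //= subr_eq0; apply/negP.
    by apply: (emb_inj_step pr_q _ lt_rd le_r); apply: leq_ltn_trans lt_ML.
  suff adj : cay_adj (Sset :|: Dset) (a%:Z * emb L x)%:~R (a%:Z * emb L y)%:~R.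
    by have := proper _ _ adj; rewrite eq_xy eqxx.
  rewrite /cay_adj ne_uv -rmorphB /= -mulrBr; apply/orP; left.
  by rewrite inE; apply/orP; left; apply/imsetP; exists (y, x) => //; rewrite inE.
Qed.
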